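(* Assume the standing setup below. Let $\rho_r>0$ and $\gamma_1>0$, set $\rho=\rho_r+\gamma_1$, and suppose (C1) $\|\mathcal{G}_{xm}(s)\|_{\mathcal{L}_1}b_{f,\Omega(\rho_r)}<\rho_r-\|\mathcal{H}_{xv}(s)\|_{\mathcal{L}_1}\|v\|_{\mathcal{L}_\infty}-\rho_\mathrm{in}$; (C2) $\|\mathcal{G}_{xm}(s)\|_{\mathcal{L}_1}L_{f,\Omega(\rho)}<1$; (C3) $\dfrac{\|\mathcal{H}_{xm}(s)\mathcal{C}(s)B^\dagger(sI_n-A_e)\|_{\mathcal{L}_1}}{1-\|\mathcal{G}_{xm}(s)\|_{\mathcal{L}_1}L_{f,\Omega(\rho)}}\gamma_0(T)<\gamma_1$. Then $\|x\|_{\mathcal{L}_\infty}\le\rho$, $\|u_a\|_{\mathcal{L}_\infty}\le\rho_{u_a}$, $\|x_\mathrm{r}-x\|_{\mathcal{L}_\infty}\le\gamma_1$ and $\|u_\mathrm{r}-u_a\|_{\mathcal{L}_\infty}\le\gamma_2$, where $\gamma_2\triangleq\|\mathcal{C}(s)\|_{\mathcal{L}_1}L_{f,\Omega(\rho)}\gamma_1+\|\mathcal{C}(s)B^\dagger(sI_n-A_e)\|_{\mathcal{L}_1}\gamma_0(T)$ and $\rho_{u_a}\triangleq\|\mathcal{C}(s)\|_{\mathcal{L}_1}b_{f,\Omega(\rho_r)}+\gamma_2$.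
   Context: Notation: $\|\cdot\|_\infty$ is the vector $\infty$-norm / induced matrix $\infty$-norm; $\|x\|_{\mathcal{L}_\infty}=\sup_{t\ge0}\|x(t)\|_\infty$; $\Omega(\rho)=\{z:\|z\|_\infty\le\rho\}$; $\mathfrak{L}$ is Laplace transform; $B^\dagger$ is the Moore–Penrose pseudo-inverse. For a stable proper transfer matrix $\mathcal{H}(s)$, $\|\mathcal{H}(s)\|_{\mathcal{L}_1}=\sup\{\|y\|_{\mathcal{L}_\infty}: y$ the zero-initial-state output for input $u$ with $\|u\|_{\mathcal{L}_\infty}\le1\}$. Standing setup: $A_m\in\mathbb{R}^{n\times n}$ Hurwitz, $B\in\mathbb{R}^{n\times m}$ full column rank, $B_v\in\mathbb{R}^{n\times m}$; $v$ bounded piecewise-continuous; $x_0\in\mathcal{X}_0$, $\mathcal{X}_0$ compact. Uncertainty $f:[0,\infty)\times\mathbb{R}^n\to\mathbb{R}^m$: for every compact $\mathcal{Z}$ there are constants with $|f_j(t,x)-f_j(\tau,z)|\le L_{f_j,\mathcal{Z}}\|x-z\|_\infty+l_{f_j,\mathcal{Z}}|t-\tau|$, $|f_j(t,x)|\le b_{f_j,\mathcal{Z}}$ for $x,z\in\mathcal{Z}$, $t,\tau\ge0$; $L_{f,\mathcal{Z}}=\max_jL_{f_j,\mathcal{Z}}$, $b_{f,\mathcal{Z}}=\max_jb_{f_j,\mathcal{Z}}$. Filter $\mathcal{C}(s)=\mathrm{diag}(k_f^j/(s+k_f^j))$, $k_f^j>0$. $\mathcal{H}_{xm}=(sI_n-A_m)^{-1}B$,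 $\mathcal{H}_{xv}=(sI_n-A_m)^{-1}B_v$, $\mathcal{G}_{xm}=\mathcal{H}_{xm}(I_m-\mathcal{C})$, $\rho_\mathrm{in}=\|s(sI_n-A_m)^{-1}\|_{\mathcal{L}_1}\max_{x_0\in\mathcal{X}_0}\|x_0\|_\infty$. Adaptive system: $\dot x=A_mx+B_vv+B(u_a+f(t,x))$, $x(0)=x_0$, with $\mathcal{L}_1$ adaptive controller: Hurwitz $A_e$; $B^\perp\in\mathbb{R}^{n\times(n-m)}$ with $(B^\perp)^\top B=0$, $\mathrm{rank}[B\ B^\perp]=n$; predictor $\dot{\hat x}=A_mx+B_vv+B(u_a+\hat\sigma_1)+B^\perp\hat\sigma_2+A_e\tilde x$, $\hat x(0)=x_0$, $\tilde x=\hat x-x$; sample time $T>0$, $\Phi(T)=A_e^{-1}(e^{A_eT}-I_n)$; adaptive law $[\hat\sigma_1(t);\hat\sigma_2(t)]=-[B\ B^\perp]^{-1}\Phi^{-1}(T)e^{A_eT}\tilde x(iT)$ for $t\in[iT,(i+1)T)$, $i\in\mathbb{Z}_+$; control law $u_a(s)=-\mathcal{C}(s)\mathfrak{L}[\hat\sigma_1(t)]$. Reference system: $\dot x_\mathrm{r}=A_mx_\mathrm{r}+B_vv+B(u_\mathrm{r}+f(t,x_\mathrm{r}))$, $x_\mathrm{r}(0)=x_0$, $u_\mathrm{r}(s)=-\mathcal{C}(s)\mathfrak{L}[f(t,x_\mathrm{r}(t))]$. All systems are assumed to have unique continuous solutions on $[0,\infty)$. $\bar\alpha_0(T)=\int_0^T\|e^{A_e(T-\tau)}B\|_\infty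 d\tau$, $\bar\alpha_1(T)=\max_{t\in[0,T]}\|e^{A_et}\|_\infty$, $\bar\alpha_2(T)=\max_{t\in[0,T]}\int_0^t\|e^{A_e(t-\tau)}\Phi^{-1}(T)e^{A_eT}\|_\infty d\tau$, and $\gamma_0(T)=b_{f,\Omega(\rho)}\bar\alpha_0(T)(\bar\alpha_1(T)+\bar\alpha_2(T)+1)$ with $\rho=\rho_r+\gamma_1$. *)

(* Defs.v *)
From HB Require Import structures.
From mathcomp Require Import all_boot all_order all_algebra.
From mathcomp Require Import all_classical all_reals all_analysis.
Import Order.TTheory GRing.Theory Num.Theory.
Import numFieldNormedType.Exports.

Set Implicit Arguments.
Unset Strict Implicit.
Unset Printing Implicit Defensive.

Local Open Scope classical_set_scope.
Local Open Scope ring_scope.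

Section L1Defs.
Variable R : realType.

(* signals: functions of time with values in column vectors (only t >= 0 matters) *)
Definition sgn (k : nat) := R -> 'cV[R]_k.

(* induced infinity-norm of a matrix (max row sum); for a column vector this
   is the vector infinity-norm max_i |x_i| *)
Definition inorm (a b : nat) (M : 'M[R]_(a, b)) : R :=
  \big[Num.max/0]_(i < a) \sum_(j < b) `|M i j|.

Definition expmx (k : nat) (A : 'M[R]_k) : 'M[R]_k :=
  \matrix_(i, j) limn (fun N : nat => \sum_(l < N) (A ^+ l) i j / (l`!)%:R).

Definition vint (k : nat) (f : R -> 'cV[R]_k) (a b : R) : 'cV[R]_k :=
  \col_i (\int[lebesgue_measure]_(x in `[a, b]) f x i 0).

(* zero-initial-state input/output map of the state-space system
   z' = A z + B u, y = C z + D u, i.e. of the transfer matrix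
   C (sI - A)^{-1} B + D :
   y(t) = C int_0^t e^{A(t-tau)} B u(tau) dtau + D u(t) *)
Definition lti (k p q : nat) (A : 'M[R]_k) (B : 'M[R]_(k, p))
  (C : 'M[R]_(q, k)) (D : 'M[R]_(q, p)) (u : sgn p) : sgn q :=
  fun t => C *m vint (fun tau => expmx ((t - tau) *: A) *m B *m u tau) 0 t
           + D *m u t.

Definition Linf (k : nat) (x : sgn k) : R :=
  sup [set inorm (x t) | t in [set t : R | 0 <= t]].

Definition unit_input (p : nat) (u : sgn p) : Prop :=
  (forall i, measurable_fun setT (fun t => u t i 0)) /\
  (forall t, 0 <= t -> inorm (u t) <= 1).

(* L1 norm of a (stable, proper) system given by its zero-initial-state
   input/output map: sup { ||y||_{L_infty} : ||u||_{L_infty} <= 1 } *)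
Definition L1norm (p q : nat) (F : sgn p -> sgn q) : R :=
  sup [set Linf (F u) | u in @unit_input p].

(* Hurwitz: every (complex) eigenvalue a + i b, with eigenvector x + i y,
   has negative real part *)
Definition hurwitz (k : nat) (A : 'M[R]_k) : Prop :=
  forall (a b : R) (x y : 'cV[R]_k), (x != 0) || (y != 0) ->
    A *m x = a *: x - b *: y -> A *m y = b *: x + a *: y -> a < 0.

Definition pw_cont_real (g : R -> R) : Prop :=
  forall b, 0 < b -> exists s : seq R,
    (forall t, 0 < t < b -> t \notin s -> {for t, continuous g}) /\
    (forall t, 0 <= t <= b -> cvg (g x @[x --> t^'+])) /\
    (forall t, 0 < t <= b -> cvg (g x @[x --> t^'-])).

Definition pw_cont (k : nat) (v : sgn k) : Prop :=
  forall i, pw_cont_real (fun t => v t i 0).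

Definition bounded_sig (k : nat) (v : sgn k) : Prop :=
  exists M, forall t, 0 <= t -> inorm (v t) <= M.

Definition Omega (k : nat) (rho : R) : set 'cV[R]_k :=
  [set z | inorm z <= rho].

Definition f_consts (n m : nat) (f : R -> 'cV[R]_n -> 'cV[R]_m)
  (Z : set 'cV[R]_n) (L l b : 'I_m -> R) : Prop :=
  (forall j t tau x z, 0 <= t -> 0 <= tau -> Z x -> Z z ->
     `|f t x j 0 - f tau z j 0| <= L j * inorm (x - z) + l j * `|t - tau|) /\
  (forall j t x, 0 <= t -> Z x -> `|f t x j 0| <= b j).

Definition maxj (m : nat) (c : 'I_m -> R) : R := \big[Num.max/0]_(j < m) c j.

(* filter C(s) = diag(k_f^j / (s + k_f^j)) *)
Definition Kf (m : nat) (kf : 'I_m -> R) : 'M[R]_m := diag_mx (\row_j kf j).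
Definition filt (m : nat) (kf : 'I_m -> R) : sgn m -> sgn m :=
  lti (- Kf kf) (Kf kf) 1 0.

(* Moore-Penrose pseudo-inverse of a full-column-rank matrix *)
Definition pinv (n m : nat) (B : 'M[R]_(n, m)) : 'M[R]_(m, n) :=
  invmx (B^T *m B) *m B^T.

Definition Hxm (n m : nat) (Am : 'M[R]_n) (B : 'M[R]_(n, m)) : sgn m -> sgn n :=
  lti Am B 1 0.

Definition Gxm (n m : nat) (Am : 'M[R]_n) (B : 'M[R]_(n, m)) (kf : 'I_m -> R)
  : sgn m -> sgn n :=
  fun u => Hxm Am B (fun t => u t - filt kf u t).

(* C(s) B^dagger (sI - A_e).  Realization used: since
   C(s) s = K (I - C(s)) with K = diag(k_f^j),
   C(s) B^+ (sI - A_e) = K B^+ - C(s) (K B^+ + B^+ A_e)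
                       = D + Cr (sI - Ar)^{-1} Br  with
   Ar = -K, Br = K (K B^+ + B^+ A_e), Cr = -I, D = K B^+. *)
Definition CBsAe (n m : nat) (B : 'M[R]_(n, m)) (Ae : 'M[R]_n)
  (kf : 'I_m -> R) : sgn n -> sgn m :=
  lti (- Kf kf) (Kf kf *m (Kf kf *m pinv B + pinv B *m Ae)) (- 1)
      (Kf kf *m pinv B).

Definition HxmCBsAe (n m : nat) (Am : 'M[R]_n) (B : 'M[R]_(n, m))
  (Ae : 'M[R]_n) (kf : 'I_m -> R) : sgn n -> sgn n :=
  fun u => Hxm Am B (CBsAe B Ae kf u).

(* s (sI - A_m)^{-1} = I + A_m (sI - A_m)^{-1} *)
Definition sHm (n : nat) (Am : 'M[R]_n) : sgn n -> sgn n := lti Am 1 Am 1.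

Definition PhiT (n : nat) (Ae : 'M[R]_n) (T : R) : 'M[R]_n :=
  invmx Ae *m (expmx (T *: Ae) - 1).

Definition alpha0 (n m : nat) (Ae : 'M[R]_n) (B : 'M[R]_(n, m)) (T : R) : R :=
  \int[lebesgue_measure]_(tau in `[0, T]) inorm (expmx ((T - tau) *: Ae) *m B).

Definition alpha1 (n : nat) (Ae : 'M[R]_n) (T : R) : R :=
  sup [set inorm (expmx (t *: Ae)) | t in `[0, T]].

Definition alpha2 (n : nat) (Ae : 'M[R]_n) (T : R) : R :=
  sup [set (\int[lebesgue_measure]_(tau in `[0, t])
             inorm (expmx ((t - tau) *: Ae) *m invmx (PhiT Ae T)
                      *m expmx (T *: Ae))) | t in `[0, T]].

Definition gamma0 (n m : nat) (Ae : 'M[R]_n) (B : 'M[R]_(n, m)) (T bf : R) : R :=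
  bf * alpha0 Ae B T * (alpha1 Ae T + alpha2 Ae T + 1).

(* The closed-loop adaptive system with the L1 adaptive controller
   (state dimension n = m + p, p = n - m; B^perp : n x p),
   written in integral form on [0, +oo).
   sh = [sigma_hat_1; sigma_hat_2]. *)
Definition adaptive_sol (m p : nat) (Am : 'M[R]_(m + p)) (Bv : 'M[R]_(m + p, m))
  (B : 'M[R]_(m + p, m)) (Bp : 'M[R]_(m + p, p)) (Ae : 'M[R]_(m + p))
  (kf : 'I_m -> R) (T : R) (v : sgn m) (f : R -> 'cV[R]_(m + p) -> 'cV[R]_m)
  (x0 : 'cV[R]_(m + p))
  (x xh : sgn (m + p)) (sh : sgn (m + p)) (ua : sgn m) : Prop :=
  {within [set t : R | 0 <= t], continuous x} /\
  {within [set t : R | 0 <= t], continuous xh} /\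
  (forall t, 0 <= t ->
     x t = x0 + vint (fun tau => Am *m x tau + Bv *m v tau
                                  + B *m (ua tau + f tau (x tau))) 0 t) /\
  (forall t, 0 <= t ->
     xh t = x0 + vint (fun tau => Am *m x tau + Bv *m v tau
                                   + B *m (ua tau + usubmx (sh tau))
                                   + Bp *m dsubmx (sh tau)
                                   + Ae *m (xh tau - x tau)) 0 t) /\
  (forall (i : nat) t, i%:R * T <= t < i.+1%:R * T ->
     sh t = - (invmx (row_mx B Bp) *m invmx (PhiT Ae T) *m expmx (T *: Ae)
               *m (xh (i%:R * T) - x (i%:R * T)))) /\
  (forall t, 0 <= t -> ua t = - filt kf (fun tau => usubmx (sh tau)) t).

Definition ref_sol (n m : nat) (Am : 'M[R]_n) (Bv : 'M[R]_(n, m))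
  (B : 'M[R]_(n, m)) (kf : 'I_m -> R) (v : sgn m) (f : R -> 'cV[R]_n -> 'cV[R]_m)
  (x0 : 'cV[R]_n) (xr : sgn n) (ur : sgn m) : Prop :=
  {within [set t : R | 0 <= t], continuous xr} /\
  (forall t, 0 <= t ->
     xr t = x0 + vint (fun tau => Am *m xr tau + Bv *m v tau
                                   + B *m (ur tau + f tau (xr tau))) 0 t) /\
  (forall t, 0 <= t -> ur t = - filt kf (fun tau => f tau (xr tau)) t).

End L1Defs.

(* Main.v *)
(** A Hurwitz matrix [A] has exponentially decaying [e^{tA}]: if
    [e^{tA} (A - z) M] decays and [Re z < 0] then so does [e^{tA} M], and by
    Cayley-Hamilton the product of the [A - z] over the complex eigenvalues [z]
    vanishes.  Hence all the transfer functions involved have finite L1 norms,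
    and by causality such a norm bounds the output on [[0, t]] by the input on
    [[0, t]].

    The adaptive law cancels, over each sampling period, the free response of
    the prediction error [xh - x], which therefore stays below [gamma0] as long
    as [|x| <= rho].  The dynamics of [xh - x] turn [C(s)] applied to
    [sigma_hat_1 - f(t, x)] into [C(s) B^+ (s - Ae)] applied to [xh - x], so that
    [xr - x = Gxm (f(t, xr) - f(t, x)) + Hxm C B^+ (s - Ae) (xh - x)].  Under
    (C1) the reference state never reaches the boundary of [Omega rho_r], and
    under (C2)-(C3) the difference [xr - x] never reaches [gamma1], by two
    continuity arguments. *)

From HB Require Import structures.
From mathcomp Require Import all_boot all_order all_algebra.
From mathcomp Require Import all_classical all_reals all_analysis.
From mathcomp Require Import measurable_realfun complex ring lra.
Require Import Defs.
Import Order.TTheory GRing.Theory Num.Theory.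
Import numFieldNormedType.Exports.

Set Implicit Arguments.
Unset Strict Implicit.
Unset Printing Implicit Defensive.

Local Open Scope classical_set_scope.
Local Open Scope ring_scope.

Section ContinuousFunctions.
Variable R : realType.
Implicit Types (h : R -> R) (a b t : R).

Lemma is_derive_continuous (W : normedModType R) (F F' : R -> W) :
  (forall t, is_derive t 1 F (F' t)) -> continuous F.
Proof.
by move=> dF t; apply: differentiable_continuous; apply/derivable1_diffP.
Qed.

Lemma is_derive_reflect (W : normedModType R) (F : R -> W) a t dF :
  is_derive (a - t) 1 F dF -> is_derive t 1 (fun s => F (a - s)) (- dF).
Proof.
move=> [/derivable1_diffP dfF FE].
have dB : is_diff t (fun s : R => a - s) (fun s => - s).
  have := is_diffB (is_diff_cst a t) (is_diff_id t).
  by congr (is_diff _ _ _); apply/funext => s; rewrite !fctE sub0r.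
split; first exact/derivable1_diffP/differentiable_comp.
rewrite deriveE; last exact: differentiable_comp.
by rewrite diff_comp// /= diff_val/= linearN -deriveE// FE.
Qed.

Lemma continuous_reflect (S : topologicalType) (F : R -> S) a :
  continuous F -> continuous (fun t => F (a - t)).
Proof.
move=> cF t; apply: (@continuous_comp _ _ _ (fun s : R => a - s) F).
  by apply: cvgB; [exact: cvg_cst|exact: cvg_id].
exact: cF.
Qed.

Lemma is_derive_expRM a t :
  is_derive t 1 (fun s => expR (a * s)) (a * expR (a * t)).
Proof.
have daM : is_derive t 1 (fun s : R => a * s) a.
  by have := is_deriveZ a (is_derive_id t 1); rewrite /GRing.scale/= mulr1.
have := @is_derive1_comp _ expR (fun s => a * s) t _ a (is_derive_expR _) daM.
by rewrite mulrC.
Qed.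

Lemma within_ge0_itv (S : topologicalType) (F : R -> S) a b : 0 <= a ->
  {within [set t : R | 0 <= t], continuous F} ->
  {within `[a, b], continuous F}.
Proof.
move=> a0; apply: continuous_subspaceW => t /=; rewrite in_itv/= => /andP[+ _].
exact: le_trans.
Qed.

Lemma quadratic_modulus_cst h (M a b : R) : a <= b ->
  (forall s t, a <= s -> s <= t -> t <= b -> `|h t - h s| <= M * (t - s) ^+ 2) ->
  h b = h a.
Proof.
move=> ab hM.
have hM2 n : forall s t, a <= s -> s <= t -> t <= b ->
    `|h t - h s| <= M * (t - s) ^+ 2 / 2 ^+ n.
  elim: n => [|n IH] s t sa st tb; first by rewrite expr0 divr1 hM.
  have left_half := IH s ((s + t) / 2) sa ltac:(lra) ltac:(lra).
  have right_half := IH ((s + t) / 2) t ltac:(lra) ltac:(lra) tb.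
  rewrite -[h t](subrK (h ((s + t) / 2))) -addrA (le_trans (ler_normD _ _))//.
  rewrite (le_trans (lerD right_half left_half))//.
  rewrite [2 ^+ n.+1]exprS invfM !mulrA -mulrDl.
  rewrite ler_wpM2r ?invr_ge0 ?exprn_ge0// le_eqVlt; apply/orP; left.
  by apply/eqP; field.
apply/eqP; rewrite -subr_eq0 -normr_le0 leNgt; apply/negP => hab0.
pose n := Num.bound (M * (b - a) ^+ 2 / `|h b - h a|).
have : M * (b - a) ^+ 2 / `|h b - h a| < 2 ^+ n.
  exact: upper_nthrootP.
by apply/negP; rewrite -leNgt ler_pdivlMr// mulrC -ler_pdivlMr ?exprn_gt0 ?hM2.
Qed.

Lemma continuous_barrier h (c : R) :
  {within [set t : R | 0 <= t], continuous h} -> h 0 <= c ->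
  (forall t, 0 <= t -> (forall s, 0 <= s <= t -> h s <= c) -> h t < c) ->
  forall t, 0 <= t -> h t < c.
Proof.
move=> ch h0 step b b0; rewrite ltNge; apply/negP => chb.
have {}ch r : {within `[0, r], continuous h} by exact: within_ge0_itv ch.
pose late := `[0, b] `&` h @^-1` [set y | c <= y].
have late_compact : compact late.
  apply: (subclosed_compact _ (@segment_compact _ 0 b)); last exact: subIsetl.
  rewrite /late setIC closed_setIS; last exact: interval_closed.
  by move/continuous_closedP: (ch b); apply; exact: closed_ge.
have late_ne : late !=set0 by exists b; split => //=; rewrite in_itv/= b0 lexx.
have [t /set_mem[/= + cht] t_first] :=
  compact_EVT_min late_ne late_compact (continuous_subspaceT (fun _ => cvg_id)).
rewrite in_itv/= => /andP[t0 tb].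
have before s : 0 <= s -> s < t -> h s < c.
  move=> s0 st; rewrite ltNge; apply/negP => chs.
  suff : t <= s by rewrite leNgt st.
  by apply/t_first/mem_set; rewrite /late/= in_itv/= s0 (le_trans (ltW st)).
have htc : h t <= c.
  rewrite leNgt; apply/negP => ht_gt.
  have [|s] := IVT (v := c) t0 (ch t); first by rewrite ge_min le_max h0 cht orbT.
  rewrite in_itv/= => /andP[s0]; rewrite le_eqVlt => /predU1P[->|st] hsc.
    by move: ht_gt; rewrite hsc ltxx.
  by have := before s s0 st; rewrite hsc ltxx.
suff : h t < c by rewrite ltNge cht.
apply: step => // s /andP[s0]; rewrite le_eqVlt => /predU1P[->//|st].
exact/ltW/before.
Qed.

End ContinuousFunctions.

Section LocallyBoundedFunctions.
Variable R : realType.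
Implicit Types (f g : R -> R) (a b c s t M : R).
Local Notation mu := (@lebesgue_measure R).

Definition Linfloc f := forall b,
  measurable_fun `[0, b] f /\ exists M, forall t, 0 <= t <= b -> `|f t| <= M.

Lemma eq_Linfloc f g : (forall t, 0 <= t -> f t = g t) -> Linfloc f -> Linfloc g.
Proof.
move=> fg lf b; have [mf [M fM]] := lf b; split.
  apply: eq_measurable_fun mf => t; rewrite inE/= in_itv/= => /andP[t0 _].
  exact: fg.
by exists M => t /[dup] /fM + /andP[t0 _]; rewrite fg.
Qed.

Lemma Linfloc_cst c : Linfloc (fun=> c).
Proof. by move=> b; split; [exact: measurable_cst|exists `|c|]. Qed.

Lemma LinflocD f g : Linfloc f -> Linfloc g -> Linfloc (fun t => f t + g t).
Proof.
move=> lf lg b; have [mf [M fM]] := lf b; have [mg [N gN]] := lg b.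
split; first exact: measurable_funD.
by exists (M + N) => t tb; rewrite (le_trans (ler_normD _ _))// lerD ?fM ?gN.
Qed.

Lemma LinflocM f g : Linfloc f -> Linfloc g -> Linfloc (fun t => f t * g t).
Proof.
move=> lf lg b; have [mf [M fM]] := lf b; have [mg [N gN]] := lg b.
split; first exact: measurable_funM.
by exists (M * N) => t tb; rewrite normrM ler_pM ?fM ?gN.
Qed.

Lemma LinflocZ f c : Linfloc f -> Linfloc (fun t => c * f t).
Proof. by move=> lf; apply: LinflocM => //; exact: Linfloc_cst. Qed.

Lemma LinflocN f : Linfloc f -> Linfloc (fun t => - f t).
Proof. by move=> /(LinflocZ (-1)); apply: eq_Linfloc => t _; rewrite mulN1r. Qed.

Lemma LinflocB f g : Linfloc f -> Linfloc g -> Linfloc (fun t => f t - g t).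
Proof. by move=> lf lg; apply: LinflocD => //; exact: LinflocN. Qed.

Lemma Linfloc_sum (I : Type) (r : seq I) (F : I -> R -> R) :
  (forall i, Linfloc (F i)) -> Linfloc (fun t => \sum_(i <- r) F i t).
Proof.
move=> lF; elim: r => [|i r IH].
  by apply: eq_Linfloc (Linfloc_cst 0) => t _; rewrite big_nil.
by apply: eq_Linfloc (LinflocD (lF i) IH) => t _; rewrite big_cons.
Qed.

Lemma within_continuous_Linfloc f :
  (forall b, 0 <= b -> {within `[0, b], continuous f}) -> Linfloc f.
Proof.
move=> cf b; have [b0|b_lt0] := leP 0 b; last first.
  rewrite set_itv_ge ?bnd_simp -?ltNge//; split; first exact: measurable_fun_set0.
  by exists 0 => t /andP[t0 tb]; move: b_lt0; rewrite ltNge (le_trans t0 tb).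
split; first by apply: subspace_continuous_measurable_fun => //; exact: cf.
have /compact_bounded[M [_ fM]] :=
  continuous_compact (cf b b0) (@segment_compact R 0 b).
exists (M + 1) => t tb; apply: fM; first by rewrite ltrDl.
by exists t => //=; rewrite in_itv.
Qed.

Lemma continuous_Linfloc f : continuous f -> Linfloc f.
Proof.
by move=> cf; apply: within_continuous_Linfloc => b _; exact: continuous_subspaceT.
Qed.

Lemma Linfloc_integrable f a b : Linfloc f -> 0 <= a ->
  mu.-integrable `[a, b] (EFin \o f).
Proof.
move=> lf a0; have [mf [M fM]] := lf b.
apply: measurable_bounded_integrable => //.
- exact/compact_finite_measure/segment_compact.
- by apply: measurable_funS mf => //; apply: subset_itvr; rewrite bnd_simp.
- exists M; split; first exact: num_real.
  move=> N MN t; rewrite /= in_itv/= => /andP[a_t tb].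
  by apply: le_trans (ltW MN); rewrite fM// (le_trans a0 a_t).
Qed.

Lemma Rintegral_itv_cst a b c : a <= b -> \int[mu]_(x in `[a, b]) c = c * (b - a).
Proof.
move=> ab; rewrite Rintegral_cst//= lebesgue_measure_itv/= lte_fin.
case: ltP => //= ba; suff -> : a = b by rewrite subrr.
by apply/eqP; rewrite eq_le ab.
Qed.

Lemma Rintegral_itv_cat f a b c : Linfloc f -> 0 <= a -> a <= b -> b <= c ->
  \int[mu]_(x in `[a, c]) f x =
  \int[mu]_(x in `[a, b]) f x + \int[mu]_(x in `[b, c]) f x.
Proof.
move=> lf a0 ab bc; apply/eqP; rewrite addrC -subr_eq; apply/eqP.
rewrite (@Rintegral_itvB R f _ _ b) ?bnd_simp//; last exact: Linfloc_integrable.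
rewrite Rintegral_itv_obnd_cbnd//.
apply: integrableS (Linfloc_integrable c lf (le_trans a0 ab)) => //.
by apply: subset_itvr; rewrite bnd_simp.
Qed.

Lemma le_normr_Rintegral_itv f g a b : Linfloc f -> Linfloc g -> 0 <= a ->
  (forall t, a <= t <= b -> `|f t| <= g t) ->
  `|\int[mu]_(x in `[a, b]) f x| <= \int[mu]_(x in `[a, b]) g x.
Proof.
move=> lf lg a0 fg; have fi := Linfloc_integrable b lf a0.
rewrite (le_trans (le_normr_Rintegral _ fi))//.
by apply: le_Rintegral => //; [exact: integrable_norm|exact: Linfloc_integrable].
Qed.

Lemma RintegralD_itv f g a b : Linfloc f -> Linfloc g -> 0 <= a ->
  \int[mu]_(x in `[a, b]) (f x + g x) =
  \int[mu]_(x in `[a, b]) f x + \int[mu]_(x in `[a, b]) g x.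
Proof.
by move=> lf lg a0; apply: RintegralD => //; exact: Linfloc_integrable.
Qed.

Lemma RintegralZl_itv f a b c : Linfloc f -> 0 <= a ->
  \int[mu]_(x in `[a, b]) (c * f x) = c * \int[mu]_(x in `[a, b]) f x.
Proof.
by move=> lf a0; apply: RintegralZl => //; exact: Linfloc_integrable.
Qed.

Lemma RintegralB_itv f g a b : Linfloc f -> Linfloc g -> 0 <= a ->
  \int[mu]_(x in `[a, b]) (f x - g x) =
  \int[mu]_(x in `[a, b]) f x - \int[mu]_(x in `[a, b]) g x.
Proof.
by move=> lf lg a0; apply: RintegralB => //; exact: Linfloc_integrable.
Qed.

Lemma Rintegral_sum_itv (I : Type) (r : seq I) (F : I -> R -> R) a b :
  (forall i, Linfloc (F i)) -> 0 <= a ->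
  \int[mu]_(x in `[a, b]) (\sum_(i <- r) F i x) =
  \sum_(i <- r) \int[mu]_(x in `[a, b]) F i x.
Proof.
move=> lF a0; elim: r => [|i r IH].
  rewrite big_nil; under eq_Rintegral do rewrite big_nil.
  by rewrite Rintegral_cst// mul0r.
rewrite big_cons -IH -RintegralD_itv//; last exact: Linfloc_sum.
by apply: eq_Rintegral => x _; rewrite big_cons.
Qed.

Lemma Rintegral_itv_FTC F f a b : a <= b -> continuous f ->
  (forall t, is_derive t 1 F (f t)) ->
  \int[mu]_(x in `[a, b]) f x = F b - F a.
Proof.
rewrite le_eqVlt => /predU1P[-> _ _|ab cf dF].
  by rewrite set_itv1 Rintegral_set1 subrr.
have cF := is_derive_continuous dF.
rewrite /Rintegral (@continuous_FTC2 _ f F)//.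
- exact: continuous_subspaceT.
- split => //.
  + by apply: cvg_at_right_filter; exact: cF.
  + by apply: cvg_at_left_filter; exact: cF.
- by move=> t _; rewrite derive1E derive_val.
Qed.

Lemma Rintegral_itv_reflect f a b t : continuous f -> a <= b ->
  \int[mu]_(x in `[a, b]) f (t - x) = \int[mu]_(x in `[t - b, t - a]) f x.
Proof.
move=> cf ab; rewrite /Rintegral; congr fine.
have dB : derive1 (fun x : R => t - x) = cst (-1).
  apply/funext => x; rewrite derive1E.
  exact/derive_val/(is_derive_reflect (is_derive_id (t - x) 1)).
have cB : continuous (fun x : R => t - x).
  by move=> x; apply: cvgB; [exact: cvg_cst|exact: cvg_id].
rewrite (@integration_by_substitution_decreasing _ (fun x => t - x))//.
- by apply: eq_integral => x _; rewrite dB /= !fctE opprK mulr1.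
- by move=> x y _ _; rewrite ltrD2l ltrN2.
- by rewrite dB => ? _; exact: cvg_cst.
- by rewrite dB; exact: is_cvg_cst.
- by rewrite dB; exact: is_cvg_cst.
- split => //.
  + by apply: cvg_at_right_filter; exact: cB.
  + by apply: cvg_at_left_filter; exact: cB.
- exact: continuous_subspaceT.
Qed.

End LocallyBoundedFunctions.

Section Primitives.
Variable R : realType.
Implicit Types (F f G g : R -> R) (s t M N : R).
Local Notation mu := (@lebesgue_measure R).

Definition primitive F f := forall s t, 0 <= s -> s <= t ->
  F t - F s = \int[mu]_(x in `[s, t]) f x.

Lemma primitive_Linfloc F f : Linfloc f -> primitive F f -> Linfloc F.
Proof.
move=> lf Ff; pose F0 t := F 0 + \int[mu]_(x in `[0, t]) f x.
apply: (eq_Linfloc (f := F0)) => [t t0|]; first by rewrite /F0 -Ff// subrKC.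
apply/LinflocD/within_continuous_Linfloc => [|b b0]; first exact: Linfloc_cst.
exact/parameterized_integral_continuous/Linfloc_integrable.
Qed.

Lemma is_derive_primitive F f :
  continuous f -> (forall t, is_derive t 1 F (f t)) -> primitive F f.
Proof. by move=> cf dF s t _ st; rewrite (Rintegral_itv_FTC st cf dF). Qed.

Lemma primitive_lipschitz F f M s t : Linfloc f -> primitive F f ->
  0 <= s -> s <= t -> (forall x, s <= x <= t -> `|f x| <= M) ->
  `|F t - F s| <= M * (t - s).
Proof.
move=> lf Ff s0 st fM; rewrite Ff// -Rintegral_itv_cst//.
exact: le_normr_Rintegral_itv lf (Linfloc_cst M) s0 fM.
Qed.

Section Product.
Variables (F f G g : R -> R).
Hypotheses (lf : Linfloc f) (lg : Linfloc g).
Hypotheses (Ff : primitive F f) (Gg : primitive G g).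

Let lF : Linfloc F := primitive_Linfloc lf Ff.
Let lG : Linfloc G := primitive_Linfloc lg Gg.
Let lfG : Linfloc (fun x => f x * G x + F x * g x).
Proof. by apply: LinflocD; exact: LinflocM. Qed.

Lemma primitiveM_remainder s t : 0 <= s -> s <= t ->
  F t * G t - F s * G s - \int[mu]_(x in `[s, t]) (f x * G x + F x * g x) =
  \int[mu]_(x in `[s, t]) (f x * (G t - G x) - (F x - F s) * g x).
Proof.
move=> s0 st; have -> : F t * G t - F s * G s =
  G t * (F t - F s) + F s * (G t - G s) by ring.
rewrite Ff// Gg// -!RintegralZl_itv// -RintegralD_itv; [|exact: LinflocZ..|by []].
rewrite -RintegralB_itv//; last by apply: LinflocD; exact: LinflocZ.
by apply: eq_Rintegral => x _; ring.
Qed.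

Lemma primitiveM_remainder_le M N s t : 0 <= s -> s <= t ->
  (forall x, s <= x <= t -> `|f x| <= M) ->
  (forall x, s <= x <= t -> `|g x| <= N) ->
  `|F t * G t - F s * G s - \int[mu]_(x in `[s, t]) (f x * G x + F x * g x)| <=
  2 * M * N * (t - s) ^+ 2.
Proof.
move=> s0 st fM gN; rewrite primitiveM_remainder//.
have -> : 2 * M * N * (t - s) ^+ 2 =
  (M * (N * (t - s)) + M * (t - s) * N) * (t - s) by ring.
have M0 : 0 <= M by apply: le_trans (fM s _); rewrite ?lexx.
have N0 : 0 <= N by apply: le_trans (gN s _); rewrite ?lexx.
rewrite -Rintegral_itv_cst//; apply: le_normr_Rintegral_itv => //.
- apply: LinflocB; apply: LinflocM => //; apply: LinflocB => //;
    exact: Linfloc_cst.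
- exact: Linfloc_cst.
move=> x /andP[sx xt]; rewrite (le_trans (ler_normB _ _))// !normrM.
have Gx : `|G t - G x| <= N * (t - s).
  apply: (@le_trans _ _ (N * (t - x))); last by rewrite ler_wpM2l// lerB.
  apply: primitive_lipschitz Gg _ xt _; rewrite ?(le_trans s0)// => y /andP[xy yt].
  by rewrite gN// (le_trans sx).
have Fx : `|F x - F s| <= M * (t - s).
  apply: (@le_trans _ _ (M * (x - s))); last by rewrite ler_wpM2l// lerB.
  apply: primitive_lipschitz Ff _ sx _ => // y /andP[sy yx].
  by rewrite fM// sy (le_trans yx).
by rewrite lerD ?ler_pM ?fM ?gN// sx.
Qed.

(* The two sides have the same increments up to a quadratic error, so that
   neither factor has to be differentiable. *)
Lemma primitiveM :
  primitive (fun t => F t * G t) (fun t => f t * G t + F t * g t).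
Proof.
move=> s t s0 st; have [_ [M fM]] := lf t; have [_ [N gN]] := lg t.
pose H r := F r * G r - \int[mu]_(x in `[s, r]) (f x * G x + F x * g x).
suff : H t = H s by rewrite /H set_itv1 Rintegral_set1; lra.
apply: (@quadratic_modulus_cst _ _ (2 * M * N)) => // r r' sr rr' r't.
have r0 := le_trans s0 sr.
have -> : H r' - H r = F r' * G r' - F r * G r -
    \int[mu]_(x in `[r, r']) (f x * G x + F x * g x).
  by rewrite /H (Rintegral_itv_cat lfG s0 sr rr'); ring.
by apply: primitiveM_remainder_le => // x /andP[rx xr'];
  rewrite ?fM ?gN// (le_trans r0 rx) (le_trans xr' r't).
Qed.

End Product.

End Primitives.

Section MatrixCalculus.
Variable R : realType.
Implicit Types (m n p : nat) (t : R).

Lemma cvg_mxP (T : Type) (F : set_system T) {FF : Filter F} m n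
    (f : T -> 'M[R]_(m, n)) (M : 'M[R]_(m, n)) :
  f x @[x --> F] --> M <-> forall i j, f x i j @[x --> F] --> M i j.
Proof.
split=> [fM i j|fM].
  exact: (cvg_comp f (fun N : 'M[R]_(m, n) => N i j) fM
    (@coord_continuous R m n i j M)).
apply/cvgrPdist_le => e e0; near=> x.
rewrite [leLHS]/Num.Def.normr/= mx_normrE (bigmax_le _ (ltW e0))//= => -[i j] _.
rewrite !mxE/=; move: (i) (j); near: x.
apply: filter_forall => i; apply: filter_forall => j.
exact: (cvgrPdist_le _ _).1 (fM i j) e e0.
Unshelve. all: by end_near. Qed.

Lemma continuous_mxP m n (F : R -> 'M[R]_(m, n)) :
  continuous F <-> forall i j, continuous (fun t => F t i j).
Proof.
split=> [cF i j t|cF t]; first by have /cvg_mxP := cF t; exact.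
by apply/cvg_mxP => i j; exact: cF.
Qed.

Lemma is_derive_mxP m n (F : R -> 'M[R]_(m, n)) dF t :
  is_derive t 1 F dF <-> forall i j, is_derive t 1 (fun s => F s i j) (dF i j).
Proof.
split=> [[dfF <-] i j|coord_dF].
  split; first by move/derivable_mxP: dfF.
  by rewrite derive_mx// mxE.
have dfF : derivable F t 1 by apply/derivable_mxP => i j; have [] := coord_dF i j.
split=> //; rewrite derive_mx//; apply/matrixP => i j; rewrite mxE.
by have [_] := coord_dF i j.
Qed.

Lemma cvg_mulmx (T : Type) (F : set_system T) {FF : Filter F} m n p
    (f : T -> 'M[R]_(m, n)) (g : T -> 'M[R]_(n, p))
    (M : 'M[R]_(m, n)) (N : 'M[R]_(n, p)) :
  f x @[x --> F] --> M -> g x @[x --> F] --> N ->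
  f x *m g x @[x --> F] --> M *m N.
Proof.
move=> /cvg_mxP fM /cvg_mxP gN; apply/cvg_mxP => i j; rewrite mxE.
rewrite (_ : (fun x => _) = fun x => \sum_k f x i k * g x k j); last first.
  by apply/funext => x; rewrite mxE.
apply: cvg_big => [|k _]; first exact: add_continuous.
by apply: cvgM; [exact: fM|exact: gN].
Qed.

Lemma continuous_mulmx m n p (F : R -> 'M[R]_(m, n)) (G : R -> 'M[R]_(n, p)) :
  continuous F -> continuous G -> continuous (fun t => F t *m G t).
Proof. by move=> cF cG t; apply: cvg_mulmx; [exact: cF|exact: cG]. Qed.

Lemma is_derive_mulmx m n p (F : R -> 'M[R]_(m, n)) (G : R -> 'M[R]_(n, p))
    t dF dG :
  is_derive t 1 F dF -> is_derive t 1 G dG ->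
  is_derive t 1 (fun s => F s *m G s) (dF *m G t + F t *m dG).
Proof.
move=> /is_derive_mxP hF /is_derive_mxP hG; apply/is_derive_mxP => i j.
have := is_derive_sum (fun k => is_deriveM (hF i k) (hG k j)).
congr (is_derive t 1 _ _).
  by apply/funext => s; rewrite fct_sumE mxE.
rewrite !mxE -big_split/=; apply: eq_bigr => k _.
by rewrite addrC /GRing.scale/= [G t k j * _]mulrC.
Qed.

End MatrixCalculus.

Section InducedNorm.
Variable R : realType.
Implicit Types (m n : nat) (c : R).

Lemma inorm_ge0 m n (M : 'M[R]_(m, n)) : 0 <= inorm M.
Proof. exact: bigmax_ge_id. Qed.

Lemma inorm_row_le m n (M : 'M[R]_(m, n)) i : \sum_j `|M i j| <= inorm M.
Proof. exact: (le_bigmax _ (fun i => \sum_j `|M i j|)). Qed.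

Lemma inorm_le m n (M : 'M[R]_(m, n)) c : 0 <= c ->
  (forall i, \sum_j `|M i j| <= c) -> inorm M <= c.
Proof. by move=> c0 Mc; apply: bigmax_le. Qed.

Lemma inorm_col_ge m (x : 'cV[R]_m) i : `|x i 0| <= inorm x.
Proof. by have := inorm_row_le x i; rewrite big_ord1. Qed.

Lemma inorm_col_le m (x : 'cV[R]_m) c : 0 <= c ->
  (forall i, `|x i 0| <= c) -> inorm x <= c.
Proof. by move=> c0 xc; apply: inorm_le => // i; rewrite big_ord1. Qed.

Lemma inorm_le_sum m n (M : 'M[R]_(m, n)) : inorm M <= \sum_i \sum_j `|M i j|.
Proof.
apply: inorm_le => [|i]; first by do 2![apply: sumr_ge0 => ? _].
by rewrite [leRHS](bigD1 i)//= lerDl; do 2![apply: sumr_ge0 => ? _].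
Qed.

Lemma inorm0 m n : inorm (0 : 'M[R]_(m, n)) = 0.
Proof.
apply/le_anti; rewrite inorm_ge0 andbT; apply: inorm_le => // i.
by rewrite big1// => j _; rewrite mxE normr0.
Qed.

Lemma inormD m n (M N : 'M[R]_(m, n)) : inorm (M + N) <= inorm M + inorm N.
Proof.
apply: inorm_le; first by rewrite addr_ge0 ?inorm_ge0.
move=> i; rewrite (le_trans _ (lerD (inorm_row_le M i) (inorm_row_le N i)))//.
by rewrite -big_split/=; apply: ler_sum => j _; rewrite mxE ler_normD.
Qed.

Lemma inormN m n (M : 'M[R]_(m, n)) : inorm (- M) = inorm M.
Proof.
by apply: eq_bigr => i _; apply: eq_bigr => j _; rewrite mxE normrN.
Qed.

Lemma inormB m n (M N : 'M[R]_(m, n)) : inorm (M - N) <= inorm M + inorm N.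
Proof. by rewrite -(inormN N) inormD. Qed.

Lemma inorm_mulmx m n p (M : 'M[R]_(m, n)) (N : 'M[R]_(n, p)) :
  inorm (M *m N) <= inorm M * inorm N.
Proof.
apply: inorm_le => [|i]; first by rewrite mulr_ge0 ?inorm_ge0.
apply: (@le_trans _ _ (\sum_k \sum_j `|M i k| * `|N k j|)).
  rewrite exchange_big/=; apply: ler_sum => j _.
  rewrite mxE (le_trans (ler_norm_sum _ _ _))//.
  by apply: ler_sum => k _; rewrite normrM.
apply: (@le_trans _ _ (\sum_k `|M i k| * inorm N)).
  by apply: ler_sum => k _; rewrite -mulr_sumr ler_wpM2l// inorm_row_le.
by rewrite -mulr_suml ler_wpM2r ?inorm_ge0// inorm_row_le.
Qed.

Lemma inormZ m n (M : 'M[R]_(m, n)) c : inorm (c *: M) = `|c| * inorm M.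
Proof.
have normcM := fun x y => maxr_pMr x y (normr_ge0 c).
rewrite [RHS](big_morph _ normcM (mulr0 _)).
apply: eq_bigr => i _; rewrite mulr_sumr; apply: eq_bigr => j _.
by rewrite mxE normrM.
Qed.

Lemma inorm_eq0 m n (M : 'M[R]_(m, n)) : (inorm M == 0) = (M == 0).
Proof.
apply/eqP/eqP => [M0|->]; last exact: inorm0.
apply/matrixP => i j; rewrite mxE; apply/normr0_eq0/le_anti.
rewrite normr_ge0 andbT -M0 (le_trans _ (inorm_row_le M i))//.
by rewrite (bigD1 j)//= lerDl sumr_ge0.
Qed.

Lemma inorm_continuous m n : continuous (@inorm R m n).
Proof.
apply: continuous_big => [|i _]; first exact: max_continuous.
apply: continuous_big => [|j _ M]; first exact: add_continuous.
exact: (continuous_comp (@coord_continuous R m n i j M) (@norm_continuous _ _ _)).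
Qed.

Lemma compact_inorm_bounded m n (X : set 'M[R]_(m, n)) : compact X ->
  has_ubound [set inorm M | M in X].
Proof.
move=> /(continuous_compact (continuous_subspaceT (@inorm_continuous m n))).
move=> /compact_bounded[c [_ Xc]]; exists (c + 1) => _ [M XM <-].
by rewrite (le_trans (ler_norm _))// Xc ?ltrDl//; exists M.
Qed.

End InducedNorm.

Section MatrixExponential.
Variables (R : realType) (k : nat) (A : 'M[R]_k).
Implicit Types (B : 'M[R]_k) (t s : R).

Lemma exp_mx_entry_le l i j :
  `|(A ^+ l) i j| <= (\sum_p \sum_q `|A p q|) ^+ l.
Proof.
set a := \sum_p _; have a0 : 0 <= a by do 2![apply: sumr_ge0 => ? _].
have rowA p : \sum_q `|A p q| <= a.
  by rewrite /a [leRHS](bigD1 p)//= lerDl; do 2![apply: sumr_ge0 => ? _].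
elim: l i j => [|l IH] i j.
  by rewrite !expr0 mxE; case: eqP => _; rewrite ?normr1 ?normr0.
rewrite !exprS mxE (le_trans (ler_norm_sum _ _ _))//.
apply: (@le_trans _ _ (\sum_q `|A i q| * a ^+ l)).
  by apply: ler_sum => q _; rewrite normrM ler_wpM2l.
by rewrite -mulr_suml ler_wpM2r ?exprn_ge0.
Qed.

Definition expmx_coef B i j l : R := (B *m A ^+ l) i j / l`!%:R.

Lemma expmx_coef_cvg B i j t : cvgn (pseries (expmx_coef B i j) t).
Proof.
apply: normed_cvg.
pose a := \sum_p \sum_q `|A p q|; pose b := \sum_q `|B i q|.
have a0 : 0 <= a by do 2![apply: sumr_ge0 => ? _].
have b0 : 0 <= b by apply: sumr_ge0 => ? _.
apply: (@series_le_cvg _ _ (fun n => b * exp_coeff (a * `|t|) n)).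
- by move=> n; exact: normr_ge0.
- by move=> n; rewrite mulr_ge0// exp_coeff_ge0// mulr_ge0.
- move=> n; rewrite /expmx_coef /exp_coeff/= !normrM normfV normr_nat normrX.
  rewrite exprMn -!mulrA [n`!%:R^-1 * _]mulrC !mulrA.
  rewrite !ler_wpM2r ?invr_ge0 ?exprn_ge0// mxE.
  rewrite (le_trans (ler_norm_sum _ _ _))// mulr_suml; apply: ler_sum => q _.
  by rewrite normrM ler_wpM2l// exp_mx_entry_le.
- rewrite (_ : series _ = fun n => b * series (exp_coeff (a * `|t|)) n).
    by apply: is_cvgM; [exact: is_cvg_cst|exact: is_cvg_series_exp_coeff].
  by apply/funext => n; rewrite /series/= mulr_sumr.
Qed.

Lemma exprZn_mx t l : (t *: A) ^+ l = t ^+ l *: A ^+ l.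
Proof.
elim: l => [|l IH]; first by rewrite !expr0 scale1r.
by rewrite !exprS IH -mulmxE -scalemxAl -scalemxAr scalerA.
Qed.

Definition expmx_sum t N : 'M[R]_k := \sum_(l < N) (t ^+ l / l`!%:R) *: A ^+ l.

Lemma mul_expmx_sumE B t i j :
  (fun N => (B *m expmx_sum t N) i j) = pseries (expmx_coef B i j) t.
Proof.
apply/funext => N; rewrite mulmx_sumr summxE /pseries /series/= big_mkord.
by apply: eq_bigr => l _; rewrite -scalemxAr mxE mulrC mulrA mulrAC /expmx_coef.
Qed.

Lemma cvg_expmx_sum t : expmx_sum t N @[N --> \oo] --> expmx (t *: A).
Proof.
apply/cvg_mxP => i j; rewrite (_ : expmx _ i j =
  limn (pseries (expmx_coef 1 i j) t)); last first.
  rewrite mxE -mul_expmx_sumE; congr (limn _); apply/funext => N.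
  rewrite mul1mx summxE; apply: eq_bigr => l _.
  by rewrite exprZn_mx !mxE mulrAC.
rewrite (_ : (fun N => _) = pseries (expmx_coef 1 i j) t).
  exact: expmx_coef_cvg.
by rewrite -mul_expmx_sumE; apply/funext => N; rewrite mul1mx.
Qed.

Lemma lim_expmx_coef B t i j :
  limn (pseries (expmx_coef B i j) t) = (B *m expmx (t *: A)) i j.
Proof.
apply: cvg_lim => //; rewrite -mul_expmx_sumE.
have /cvg_mxP : B *m expmx_sum t N @[N --> \oo] --> B *m expmx (t *: A).
  by apply: cvg_mulmx; [exact: cvg_cst|exact: cvg_expmx_sum].
exact.
Qed.

Lemma expmx_comm t : A *m expmx (t *: A) = expmx (t *: A) *m A.
Proof.
have EA : expmx_sum t N *m A @[N --> \oo] --> expmx (t *: A) *m A.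
  by apply: cvg_mulmx; [exact: cvg_expmx_sum|exact: cvg_cst].
apply: (cvg_unique (@norm_hausdorff _ _) _ EA).
rewrite (_ : (fun N => _) = fun N => A *m expmx_sum t N).
  by apply: cvg_mulmx; [exact: cvg_cst|exact: cvg_expmx_sum].
apply/funext => N; rewrite mulmx_suml mulmx_sumr; apply: eq_bigr => l _.
by rewrite -scalemxAr -scalemxAl !mulmxE -exprS -exprSr.
Qed.

Lemma is_derive_expmx t :
  is_derive t 1 (fun s => expmx (s *: A)) (A *m expmx (t *: A)).
Proof.
apply/is_derive_mxP => i j.
have diffs B : pseries_diffs (expmx_coef B i j) = expmx_coef (B *m A) i j.
  apply/funext => l; rewrite /pseries_diffs /expmx_coef -mulmxA mulmxE -exprS.
  by rewrite factS natrM invfM mulrCA mulVKf// pnatr_eq0.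
rewrite (_ : (fun s => _) = fun s => limn (pseries (expmx_coef 1 i j) s)).
  rewrite -lim_expmx_coef; have := diffs 1; rewrite mul1mx => <-.
  apply: (@pseries_snd_diffs _ _ (`|t| + 1)); rewrite ?diffs.
  - exact: expmx_coef_cvg.
  - exact: expmx_coef_cvg.
  - exact: expmx_coef_cvg.
  - by rewrite [ltRHS]ger0_norm ?ltrDl// addr_ge0.
by apply/funext => s; rewrite lim_expmx_coef mul1mx.
Qed.

Lemma continuous_expmx : continuous (fun t => expmx (t *: A)).
Proof. exact: is_derive_continuous is_derive_expmx. Qed.

Lemma continuous_expmx_reflect t : continuous (fun s => expmx ((t - s) *: A)).
Proof.
exact: (@continuous_reflect _ _ (fun s => expmx (s *: A)) t continuous_expmx).
Qed.

Lemma is_derive_expmx_reflect t s :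
  is_derive s 1 (fun s => expmx ((t - s) *: A)) (- (A *m expmx ((t - s) *: A))).
Proof.
exact: (@is_derive_reflect _ _ (fun s => expmx (s *: A))) (is_derive_expmx _).
Qed.

Lemma expmx0 : expmx (0 *: A) = 1.
Proof.
rewrite -[LHS]mul1mx; apply/matrixP => i j; rewrite -lim_expmx_coef.
apply: cvg_lim => //.
apply: (@cvg_near_cst) => //; exists 1%N => // -[//|n] _.
rewrite /pseries /series/= big_nat_recl// big1 ?addr0 => [|l _].
  by rewrite /expmx_coef mul1mx !expr0 mulr1 fact0 divr1.
by rewrite expr0n mulr0.
Qed.

Lemma expmxD s t : expmx ((s + t) *: A) = expmx (s *: A) *m expmx (t *: A).
Proof.
pose h r := expmx ((s + t - r) *: A) *m expmx (r *: A).
have dh (r : R) : is_derive r 1 h 0.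
  have := is_derive_mulmx (is_derive_expmx_reflect (s + t) r) (is_derive_expmx r).
  by rewrite expmx_comm mulNmx mulmxA addNr.
have : h 0 = h t.
  apply/matrixP => i j.
  apply: (@is_derive_0_is_cst _ (fun r => h r i j)) => r.
  by have /is_derive_mxP/(_ i j) := dh r; rewrite mxE.
by rewrite /h subr0 addrK expmx0 mulmx1.
Qed.

Lemma expmxMn n t : expmx ((n%:R * t) *: A) = expmx (t *: A) ^+ n.
Proof.
elim: n => [|n IH]; first by rewrite mul0r expmx0.
by rewrite -natr1 mulrDl mul1r expmxD IH exprSr.
Qed.

End MatrixExponential.

Section MatrixSignals.
Variable R : realType.
Implicit Types (m n p : nat) (s t c : R).
Local Notation mu := (@lebesgue_measure R).

Definition mxLinfloc m n (F : R -> 'M[R]_(m, n)) :=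
  forall i j, Linfloc (fun t => F t i j).

Lemma eq_mxLinfloc m n (F G : R -> 'M[R]_(m, n)) :
  (forall t, 0 <= t -> F t = G t) -> mxLinfloc F -> mxLinfloc G.
Proof. by move=> FG lF i j; apply: eq_Linfloc (lF i j) => t /FG ->. Qed.

Lemma mxLinfloc_cst m n (M : 'M[R]_(m, n)) : mxLinfloc (fun=> M).
Proof. by move=> i j; exact: Linfloc_cst. Qed.

Lemma mxLinflocD m n (F G : R -> 'M[R]_(m, n)) :
  mxLinfloc F -> mxLinfloc G -> mxLinfloc (fun t => F t + G t).
Proof.
move=> lF lG i j; apply: eq_Linfloc (LinflocD (lF i j) (lG i j)) => t _.
by rewrite mxE.
Qed.

Lemma mxLinflocN m n (F : R -> 'M[R]_(m, n)) :
  mxLinfloc F -> mxLinfloc (fun t => - F t).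
Proof.
by move=> lF i j; apply: eq_Linfloc (LinflocN (lF i j)) => t _; rewrite mxE.
Qed.

Lemma mxLinflocB m n (F G : R -> 'M[R]_(m, n)) :
  mxLinfloc F -> mxLinfloc G -> mxLinfloc (fun t => F t - G t).
Proof. by move=> lF lG; apply: mxLinflocD => //; exact: mxLinflocN. Qed.

Lemma mxLinflocZ m n c (F : R -> 'M[R]_(m, n)) :
  mxLinfloc F -> mxLinfloc (fun t => c *: F t).
Proof.
by move=> lF i j; apply: eq_Linfloc (LinflocZ c (lF i j)) => t _; rewrite mxE.
Qed.

Lemma mxLinflocM m n p (F : R -> 'M[R]_(m, n)) (G : R -> 'M[R]_(n, p)) :
  mxLinfloc F -> mxLinfloc G -> mxLinfloc (fun t => F t *m G t).
Proof.
move=> lF lG i j.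
apply: (eq_Linfloc (f := fun t => \sum_k F t i k * G t k j)) => [t _|].
  by rewrite mxE.
by apply: Linfloc_sum => k; exact: LinflocM.
Qed.

Lemma mxLinflocMl m n p (M : 'M[R]_(m, n)) (G : R -> 'M[R]_(n, p)) :
  mxLinfloc G -> mxLinfloc (fun t => M *m G t).
Proof. by move=> lG; apply: mxLinflocM => //; exact: mxLinfloc_cst. Qed.

Lemma mxLinfloc_usubmx m n p (F : R -> 'M[R]_(m + n, p)) :
  mxLinfloc F -> mxLinfloc (fun t => usubmx (F t)).
Proof.
by move=> lF i j; apply: eq_Linfloc (lF (lshift n i) j) => t _; rewrite mxE.
Qed.

Lemma continuous_mxLinfloc m n (F : R -> 'M[R]_(m, n)) :
  continuous F -> mxLinfloc F.
Proof. by move=> /continuous_mxP cF i j; exact: continuous_Linfloc. Qed.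

Lemma mxLinfloc_expmx n (A : 'M[R]_n) : mxLinfloc (fun s => expmx (s *: A)).
Proof. exact/continuous_mxLinfloc/continuous_expmx. Qed.

Lemma mxLinfloc_expmx_reflect n (A : 'M[R]_n) t :
  mxLinfloc (fun s => expmx ((t - s) *: A)).
Proof. exact/continuous_mxLinfloc/continuous_expmx_reflect. Qed.

Lemma eq_vint n (f g : R -> 'cV[R]_n) s t :
  (forall r, s <= r <= t -> f r = g r) -> vint f s t = vint g s t.
Proof.
move=> fg; apply/colP => i; rewrite !mxE; apply: eq_Rintegral => r.
by rewrite inE/= in_itv/= => /fg ->.
Qed.

Lemma eq_vint_co n (f g : R -> 'cV[R]_n) s t : mxLinfloc f -> mxLinfloc g ->
  0 <= s -> (forall r, s <= r < t -> f r = g r) -> vint f s t = vint g s t.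
Proof.
move=> lf lg s0 fg; apply/colP => i; rewrite !mxE.
have intgbl_co h : Linfloc h -> mu.-integrable `[s, t[ (EFin \o h).
  move=> lh; apply: integrableS (Linfloc_integrable t lh s0) => //.
  by apply: subset_itvl; rewrite bnd_simp.
rewrite -(Rintegral_itv_bndo_bndc (intgbl_co _ (lf i 0))).
rewrite -(Rintegral_itv_bndo_bndc (intgbl_co _ (lg i 0))).
by apply: eq_Rintegral => r; rewrite inE/= in_itv/= => /fg ->.
Qed.

Lemma vintxx n (f : R -> 'cV[R]_n) t : vint f t t = 0.
Proof. by apply/colP => i; rewrite !mxE set_itv1 Rintegral_set1. Qed.

Lemma vintD n (f g : R -> 'cV[R]_n) s t : mxLinfloc f -> mxLinfloc g ->
  0 <= s -> vint (fun r => f r + g r) s t = vint f s t + vint g s t.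
Proof.
move=> lf lg s0; apply/colP => i; rewrite !mxE -RintegralD_itv//.
by apply: eq_Rintegral => r _; rewrite mxE.
Qed.

Lemma mulmx_vint m n (M : 'M[R]_(m, n)) (f : R -> 'cV[R]_n) s t :
  mxLinfloc f -> 0 <= s -> M *m vint f s t = vint (fun r => M *m f r) s t.
Proof.
move=> lf s0; apply/colP => i; rewrite !mxE.
under eq_bigr do rewrite mxE -RintegralZl_itv//.
rewrite -Rintegral_sum_itv//; first by apply: eq_Rintegral => r _; rewrite mxE.
by move=> k; exact: LinflocZ.
Qed.

Lemma vintN n (f : R -> 'cV[R]_n) s t : mxLinfloc f -> 0 <= s ->
  vint (fun r => - f r) s t = - vint f s t.
Proof.
move=> lf s0; rewrite -[RHS]mul1mx mulmxN -mulNmx mulmx_vint//.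
by apply: eq_vint => r _; rewrite mulNmx mul1mx.
Qed.

Lemma vintB n (f g : R -> 'cV[R]_n) s t : mxLinfloc f -> mxLinfloc g ->
  0 <= s -> vint (fun r => f r - g r) s t = vint f s t - vint g s t.
Proof. by move=> lf lg s0; rewrite vintD ?vintN//; exact: mxLinflocN. Qed.

Lemma inorm_vint_le n (f : R -> 'cV[R]_n) (g : R -> R) s t :
  mxLinfloc f -> Linfloc g -> 0 <= s ->
  (forall r, s <= r <= t -> inorm (f r) <= g r) ->
  inorm (vint f s t) <= \int[mu]_(r in `[s, t]) g r.
Proof.
move=> lf lg s0 fg; apply: inorm_col_le => [|i].
  apply: Rintegral_ge0 => r /=; rewrite in_itv/= => /fg; apply: le_trans.
  exact: inorm_ge0.
rewrite mxE; apply: le_normr_Rintegral_itv => // r /fg; apply: le_trans.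
exact: inorm_col_ge.
Qed.

End MatrixSignals.

Section MatrixPrimitives.
Variable R : realType.
Implicit Types (m n p : nat) (s t : R).

Definition mxprimitive m n (F f : R -> 'M[R]_(m, n)) :=
  forall i j, primitive (fun t => F t i j) (fun t => f t i j).

Lemma mxprimitiveE n (F f : R -> 'cV[R]_n) s t : mxprimitive F f ->
  0 <= s -> s <= t -> F t = F s + vint f s t.
Proof.
move=> Ff s0 st; apply/colP => i; rewrite !mxE.
by rewrite -(Ff i 0 s t s0 st) subrKC.
Qed.

Lemma vint_mxprimitive n (F f : R -> 'cV[R]_n) (a : 'cV[R]_n) : mxLinfloc f ->
  (forall t, 0 <= t -> F t = a + vint f 0 t) -> mxprimitive F f.
Proof.
move=> lf FE i j s t s0 st; rewrite (ord1 j) !FE ?(le_trans s0)// !mxE.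
by rewrite (Rintegral_itv_cat (lf i 0) (lexx 0) s0 st); ring.
Qed.

Lemma eq_mxprimitive m n (F f g : R -> 'M[R]_(m, n)) :
  (forall t, 0 <= t -> f t = g t) -> mxprimitive F f -> mxprimitive F g.
Proof.
move=> fg Ff i j s t s0 st; rewrite (Ff i j s t s0 st); apply: eq_Rintegral => r.
by rewrite inE/= in_itv/= => /andP[sr _]; rewrite fg// (le_trans s0).
Qed.

Lemma mxprimitive_mxLinfloc m n (F f : R -> 'M[R]_(m, n)) :
  mxLinfloc f -> mxprimitive F f -> mxLinfloc F.
Proof. by move=> lf Ff i j; exact: primitive_Linfloc (lf i j) (Ff i j). Qed.

Lemma mxLinfloc_vint n (f : R -> 'cV[R]_n) :
  mxLinfloc f -> mxLinfloc (fun t => vint f 0 t).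
Proof.
move=> lf; apply: (mxprimitive_mxLinfloc lf (vint_mxprimitive (a := 0) lf _)).
by move=> t _; rewrite add0r.
Qed.

Lemma mxprimitive_cst m n (M : 'M[R]_(m, n)) : mxprimitive (fun=> M) (fun=> 0).
Proof.
move=> i j s t s0 st; rewrite subrr -[LHS](mul0r (t - s)) -Rintegral_itv_cst//.
by apply: eq_Rintegral => r _; rewrite mxE.
Qed.

Lemma is_derive_mxprimitive m n (F f : R -> 'M[R]_(m, n)) :
  continuous f -> (forall t, is_derive t 1 F (f t)) -> mxprimitive F f.
Proof.
move=> /continuous_mxP cf dF i j; apply: is_derive_primitive => // t.
by have /is_derive_mxP := dF t; exact.
Qed.

Lemma mxprimitiveM m n p (F f : R -> 'M[R]_(m, n)) (G g : R -> 'M[R]_(n, p)) :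
  mxLinfloc f -> mxLinfloc g -> mxprimitive F f -> mxprimitive G g ->
  mxprimitive (fun t => F t *m G t) (fun t => f t *m G t + F t *m g t).
Proof.
move=> lf lg Ff Gg i j s t s0 st.
have lF := mxprimitive_mxLinfloc lf Ff; have lG := mxprimitive_mxLinfloc lg Gg.
under eq_Rintegral => r _ do rewrite !mxE -big_split/=.
rewrite Rintegral_sum_itv// => [|k]; last by apply: LinflocD; exact: LinflocM.
rewrite !mxE -sumrB; apply: eq_bigr => k _.
exact: (primitiveM (lf i k) (lg k j) (Ff i k) (Gg k j)).
Qed.

Lemma mxprimitiveMl m n p (M : 'M[R]_(m, n)) (G g : R -> 'M[R]_(n, p)) :
  mxLinfloc g -> mxprimitive G g ->
  mxprimitive (fun t => M *m G t) (fun t => M *m g t).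
Proof.
move=> lg Gg; have := mxprimitiveM (mxLinfloc_cst 0) lg (mxprimitive_cst M) Gg.
by apply: eq_mxprimitive => t _; rewrite mul0mx add0r.
Qed.

Lemma mxprimitive_expmx_reflect n (A : 'M[R]_n) t :
  mxprimitive (fun s => expmx ((t - s) *: A))
    (fun s => - (A *m expmx ((t - s) *: A))).
Proof.
apply: is_derive_mxprimitive => [s|s]; last exact: is_derive_expmx_reflect.
apply: cvgN; apply: cvg_mulmx; first exact: cvg_cst.
exact: continuous_expmx_reflect.
Qed.

Lemma variation_of_constants n (A : 'M[R]_n) (X w : R -> 'cV[R]_n) s t :
  mxLinfloc X -> mxLinfloc w ->
  mxprimitive X (fun r => A *m X r + w r) -> 0 <= s -> s <= t ->
  X t = expmx ((t - s) *: A) *m X s +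
        vint (fun r => expmx ((t - r) *: A) *m w r) s t.
Proof.
move=> lX lw Xw s0 st; pose E r := expmx ((t - r) *: A).
have lE : mxLinfloc E by exact: mxLinfloc_expmx_reflect.
have EX : mxprimitive (fun r => E r *m X r) (fun r => E r *m w r).
  apply: (eq_mxprimitive (f := fun r =>
      - (A *m E r) *m X r + E r *m (A *m X r + w r))) => [r _|].
    by rewrite expmx_comm mulmxDr mulNmx mulmxA addKr.
  apply: mxprimitiveM (mxprimitive_expmx_reflect A t) Xw.
  - exact/mxLinflocN/mxLinflocMl.
  - by apply: mxLinflocD => //; exact: mxLinflocMl.
by rewrite -(mxprimitiveE EX)// /E subrr expmx0 mul1mx.
Qed.

Lemma mulmx_vint_expmx n (A : 'M[R]_n) (y : 'cV[R]_n) s t : 0 <= s -> s <= t ->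
  A *m vint (fun r => expmx ((t - r) *: A) *m y) s t =
  (expmx ((t - s) *: A) - 1) *m y.
Proof.
move=> s0 st; have lEy : mxLinfloc (fun r => expmx ((t - r) *: A) *m y).
  by apply: mxLinflocM; [exact: mxLinfloc_expmx_reflect|exact: mxLinfloc_cst].
have y_prim : mxprimitive (fun=> y) (fun=> A *m y + - (A *m y)).
  by apply: eq_mxprimitive (mxprimitive_cst y) => r _; rewrite subrr.
have := variation_of_constants (mxLinfloc_cst y) (mxLinfloc_cst _) y_prim s0 st.
rewrite (_ : vint _ s t = - (A *m vint (fun r => expmx ((t - r) *: A) *m y) s t)).
  by move=> yE; rewrite mulmxBl mul1mx [X in _ = _ - X]yE subKr.
rewrite mulmx_vint// -vintN//; last exact: mxLinflocMl.
by apply: eq_vint => r _; rewrite mulmxN !mulmxA expmx_comm.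
Qed.

End MatrixPrimitives.

Section ExponentialDecay.
Variable R : realType.
Implicit Types (u v g phi : R -> R) (a b e t C K : R).
Local Notation mu := (@lebesgue_measure R).
#[local] Existing Instance is_derive_expRM.

Lemma gronwall_expR phi dphi a b K : a != b ->
  (forall t, is_derive t 1 phi (dphi t)) ->
  (forall t, 0 < t -> dphi t <= a * phi t + K * expR (b * t)) ->
  forall t, 0 <= t ->
    phi t <= (phi 0 - K / (b - a)) * expR (a * t) + K / (b - a) * expR (b * t).
Proof.
move=> ab dphiE dphi_le t t0; have ba0 : b - a != 0 by rewrite subr_eq0 eq_sym.
pose c := K / (b - a); pose h s := (phi s - c * expR (b * s)) * expR (- a * s).
pose dh s := (dphi s - (a * phi s + K * expR (b * s))) * expR (- a * s).
have dhE (s : R) : is_derive s 1 h (dh s).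
  by apply: is_derive_eq; rewrite /dh /c /GRing.scale/=; field.
have h_cont : {within `[0, +oo[, continuous h}.
  exact/continuous_subspaceT/(is_derive_continuous dhE).
have h_le : h t <= h 0.
  apply: (ler0_derive1_nincry _ _ h_cont (lexx 0) t0) => // s.
  rewrite in_itv/= andbT => s0; rewrite derive1E derive_val /dh.
  by rewrite pmulr_lle0 ?expR_gt0// subr_le0 dphi_le.
move: h_le; rewrite /h !mulr0 expR0 !mulr1 mulNr expRN ler_pdivrMr ?expR_gt0//.
by rewrite lerBlDr.
Qed.

Lemma gronwall_expR_le phi dphi a b K : a < b -> 0 <= phi 0 -> 0 <= K ->
  (forall t, is_derive t 1 phi (dphi t)) ->
  (forall t, 0 < t -> dphi t <= a * phi t + K * expR (b * t)) ->
  forall t, 0 <= t -> phi t <= (phi 0 + K / (b - a)) * expR (b * t).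
Proof.
move=> ab phi0 K0 dphiE dphi_le t t0.
rewrite (le_trans (gronwall_expR (negbT (lt_eqF ab)) dphiE dphi_le t0))//.
rewrite [leRHS]mulrDl lerD// (@le_trans _ _ (phi 0 * expR (a * t)))//.
  by rewrite ler_wpM2r ?expR_ge0// gerBl divr_ge0// subr_ge0 ltW.
by rewrite ler_wpM2l// ler_expR ler_wpM2r// ltW.
Qed.

Definition expdecay_rate e u :=
  exists C, forall t, 0 <= t -> `|u t| <= C * expR (- e * t).

Definition expdecay u := exists2 e, 0 < e & expdecay_rate e u.

Lemma expdecay_rate_ge0 e u : expdecay_rate e u ->
  exists2 C, 0 <= C & forall t, 0 <= t -> `|u t| <= C * expR (- e * t).
Proof.
move=> [C uC]; exists C => //; have := uC 0 (lexx 0).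
by rewrite mulr0 expR0 mulr1; exact: le_trans.
Qed.

Lemma expdecay_rateW e e' u :
  e' <= e -> expdecay_rate e u -> expdecay_rate e' u.
Proof.
move=> e'e /expdecay_rate_ge0[C C0 uC]; exists C => t t0.
rewrite (le_trans (uC t t0))// ler_wpM2l// ler_expR ler_wpM2r// lerN2//.
Qed.

Lemma expdecay_common_rate u v a : 0 < a -> expdecay u -> expdecay v ->
  exists e, [/\ 0 < e, e <= a, expdecay_rate e u & expdecay_rate e v].
Proof.
move=> a0 [e1 e10 ue1] [e2 e20 ve2].
exists (Num.min a (Num.min e1 e2)); split; first by rewrite !lt_min a0 e10 e20.
- by rewrite ge_min lexx.
- by apply: expdecay_rateW ue1; rewrite !ge_min lexx orbT.
- by apply: expdecay_rateW ve2; rewrite !ge_min lexx !orbT.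
Qed.

Lemma expdecay0 : expdecay (fun=> 0).
Proof. by exists 1 => //; exists 0 => t _; rewrite normr0 mul0r. Qed.

Lemma expdecay_le u v : (forall t, 0 <= t -> `|u t| <= `|v t|) ->
  expdecay v -> expdecay u.
Proof.
move=> uv [e e0 [C vC]]; exists e => //; exists C => t t0.
exact: le_trans (uv t t0) (vC t t0).
Qed.

Lemma expdecayD u v : expdecay u -> expdecay v -> expdecay (fun t => u t + v t).
Proof.
move=> du dv; have [e [e0 _ [C uC] [D vD]]] := expdecay_common_rate ltr01 du dv.
exists e => //; exists (C + D) => t t0.
by rewrite mulrDl (le_trans (ler_normD _ _))// lerD ?uC ?vD.
Qed.

Lemma expdecay_sum (I : Type) (r : seq I) (F : I -> R -> R) :
  (forall i, expdecay (F i)) -> expdecay (fun t => \sum_(i <- r) F i t).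
Proof.
move=> dF; elim: r => [|i r IH].
  by apply: expdecay_le expdecay0 => t _; rewrite big_nil.
by apply: expdecay_le (expdecayD (dF i) IH) => t _; rewrite big_cons.
Qed.

Lemma expdecay_cvgn u t : 0 < t -> expdecay u ->
  u (n%:R * t) @[n --> \oo] --> (0 : R).
Proof.
move=> t0 [e e0 [C uC]]; pose q := expR (- e * t).
have q1 : `|q| < 1 by rewrite ger0_norm ?expR_ge0// expR_lt1 nmulr_rlt0 ?oppr_lt0.
have Cq0 : C * q ^+ n @[n --> \oo] --> (0 : R).
  by rewrite -(mulr0 C); apply: cvgM; [exact: cvg_cst|exact: cvg_expr].
have NCq0 : - (C * q ^+ n) @[n --> \oo] --> (0 : R) by rewrite -oppr0; exact: cvgN.
apply: (squeeze_cvgr _ NCq0 Cq0); near=> n.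
rewrite -ler_norml (le_trans (uC _ _)) ?mulr_ge0 ?(ltW t0)//.
by rewrite -expRM_natl mulrCA.
Unshelve. all: by end_near. Qed.

Lemma expdecay_Rintegral_le u : continuous u -> expdecay u ->
  exists M, forall t, 0 <= t -> \int[mu]_(r in `[0, t]) `|u r| <= M.
Proof.
move=> cu [e e0 /expdecay_rate_ge0[C C0 uC]]; exists (C / e) => t t0.
pose F r := - (C / e) * expR (- e * r).
have cexp : continuous (fun r : R => C * expR (- e * r)).
  by apply: is_derive_continuous => r; exact: is_derive_eq.
have dF (r : R) : is_derive r 1 F (C * expR (- e * r)).
  by apply: is_derive_eq; rewrite /GRing.scale/=; field; rewrite gt_eqF.
apply: (@le_trans _ _ (\int[mu]_(r in `[0, t]) (C * expR (- e * r)))).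
  apply: le_trans (ler_norm _) _; apply: le_normr_Rintegral_itv => //.
  - by apply: continuous_Linfloc => r; apply: cvg_norm; exact: cu.
  - exact: continuous_Linfloc.
  - by move=> r /andP[r0 _]; rewrite normr_id uC.
rewrite (Rintegral_itv_FTC t0 cexp dF) /F mulr0 expR0 mulr1 opprK gerDr.
by rewrite mulNr oppr_le0 mulr_ge0 ?expR_ge0// divr_ge0// ltW.
Qed.

(* The energy [phi = u^2 + v^2] satisfies
   [phi' <= a phi + (g1^2 + g2^2) / (- a)]. *)
Lemma expdecay_linear_ode u v g1 g2 a b : a < 0 ->
  (forall t, is_derive t 1 u (a * u t - b * v t + g1 t)) ->
  (forall t, is_derive t 1 v (b * u t + a * v t + g2 t)) ->
  expdecay g1 -> expdecay g2 -> expdecay u /\ expdecay v.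
Proof.
move=> a0 du dv dg1 dg2.
have a4_gt0 : 0 < - a / 4 by lra.
have [e [e0 ea [C1 gC1] [C2 gC2]]] := expdecay_common_rate a4_gt0 dg1 dg2.
pose phi t := u t ^+ 2 + v t ^+ 2; pose K := (C1 ^+ 2 + C2 ^+ 2) / - a.
pose dphi t := 2 * (u t * (a * u t - b * v t + g1 t) +
                    v t * (b * u t + a * v t + g2 t)).
have phi0 : 0 <= phi 0 by rewrite addr_ge0 ?sqr_ge0.
have K0 : 0 <= K by rewrite divr_ge0 ?addr_ge0 ?sqr_ge0// oppr_ge0 ltW.
have ae : a < 2 * - e by lra.
have dphiE (t : R) : is_derive t 1 phi (dphi t).
  by apply: is_derive_eq; rewrite /dphi /GRing.scale/=; ring.
have g_sqr g C t : `|g t| <= C * expR (- e * t) ->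
    g t ^+ 2 <= C ^+ 2 * expR (2 * - e * t).
  move=> gC; rewrite -[g t ^+ 2]real_normK ?num_real// -mulrA expRM_natl -exprMn.
  by rewrite lerXn2r ?nnegrE// (le_trans _ gC).
have dphi_le t : 0 < t -> dphi t <= a * phi t + K * expR (2 * - e * t).
  move=> /ltW t0; rewrite -lerBlDl /K mulrAC ler_pdivlMr ?oppr_gt0// [leRHS]mulrDl.
  apply: le_trans (lerD (g_sqr _ _ _ (gC1 t t0)) (g_sqr _ _ _ (gC2 t t0))).
  have := sqr_ge0 (a * u t + g1 t); have := sqr_ge0 (a * v t + g2 t).
  by rewrite /dphi /phi; nra.
pose M := phi 0 + K / (2 * - e - a).
have M0 : 0 <= M by rewrite addr_ge0// divr_ge0// subr_ge0 ltW.
have phi_le t : 0 <= t -> phi t <= (Num.sqrt M * expR (- e * t)) ^+ 2.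
  move=> t0; rewrite exprMn sqr_sqrtr// -expRM_natl mulrA.
  exact: (gronwall_expR_le ae phi0 K0 dphiE dphi_le).
have decay w : (forall t, w t ^+ 2 <= phi t) -> expdecay w.
  move=> w_phi; exists e => //; exists (Num.sqrt M) => t t0.
  rewrite -(@ler_pXn2r _ 2)// ?nnegrE ?mulr_ge0 ?sqrtr_ge0 ?expR_ge0//.
  by rewrite real_normK ?num_real// (le_trans (w_phi t))// phi_le.
by split; apply: decay => t; rewrite /phi ?lerDl ?lerDr sqr_ge0.
Qed.

End ExponentialDecay.

Section HurwitzMatrices.
Variables (R : realType) (k : nat).
Local Notation toC := (map_mx (real_complex R)).
Local Notation reM := (map_mx (@complex.Re R)).
Local Notation imM := (map_mx (@complex.Im R)).
Implicit Types (A X Y : 'M[R]_k) (M : 'M[R[i]]_k) (z : R[i]).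

Lemma hurwitz_char_poly_root A z : hurwitz A ->
  root (char_poly (toC A)) z -> complex.Re z < 0.
Proof.
move=> hA rz; have : eigenvalue (toC A)^T z.
  suff char_polyT : char_poly (toC A)^T = char_poly (toC A).
    by rewrite eigenvalue_root_char char_polyT.
  rewrite /char_poly -[RHS]det_tr; congr (\det _).
  by apply/matrixP => i j; rewrite !mxE eq_sym.
case/eigenvalueP => v vA v0.
have Av i : \sum_q (real_complex R) (A i q) * v 0 q = z * v 0 i.
  have /matrixP/(_ 0 i) := vA; rewrite !mxE => <-.
  by apply: eq_bigr => q _; rewrite !mxE mulrC.
pose x : 'cV[R]_k := \col_i complex.Re (v 0 i).
pose y : 'cV[R]_k := \col_i complex.Im (v 0 i).
apply: (hA (complex.Re z) (complex.Im z) x y).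
- rewrite -negb_and; apply: contra v0 => /andP[/eqP x0 /eqP y0].
  apply/eqP/rowP => i; have /colP/(_ i) := x0; have /colP/(_ i) := y0.
  by rewrite !mxE; case: (v 0 i) => /= ? ? -> ->.
- apply/colP => i; have := congr1 (@complex.Re R) (Av i).
  rewrite raddf_sum/= !mxE; case: z (v 0 i) {Av vA rz} => za zb [va vb] /= <-.
  by apply: eq_bigr => q _; rewrite mxE; case: (v 0 q) => ? ?/=; ring.
- apply/colP => i; have := congr1 (@complex.Im R) (Av i).
  rewrite raddf_sum/= !mxE; case: z (v 0 i) {Av vA rz} => za zb [va vb] /=.
  rewrite addrC => <-.
  by apply: eq_bigr => q _; rewrite mxE; case: (v 0 q) => ? ?/=; ring.
Qed.

Lemma Re_mulmx_shift A z M : reM ((toC A - z%:M) *m M) =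
  A *m reM M - complex.Re z *: reM M + complex.Im z *: imM M.
Proof.
apply/matrixP => i j; rewrite mulmxBl mul_scalar_mx !mxE raddfB raddf_sum/= -addrA.
congr (_ + _); last by case: (M i j) (z) => ? ? [? ?] /=; ring.
by apply: eq_bigr => q _; rewrite !mxE; case: (M q j) => ? ? /=; ring.
Qed.

Lemma Im_mulmx_shift A z M : imM ((toC A - z%:M) *m M) =
  A *m imM M - complex.Re z *: imM M - complex.Im z *: reM M.
Proof.
apply/matrixP => i j; rewrite mulmxBl mul_scalar_mx !mxE raddfB raddf_sum/= -addrA.
congr (_ + _); last by case: (M i j) (z) => ? ? [? ?] /=; ring.
by apply: eq_bigr => q _; rewrite !mxE; case: (M q j) => ? ? /=; ring.
Qed.

Definition expmx_decay A M := forall i j,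
  expdecay (fun t => (expmx (t *: A) *m reM M) i j) /\
  expdecay (fun t => (expmx (t *: A) *m imM M) i j).

Lemma expmx_decay0 A : expmx_decay A 0.
Proof.
by move=> i j; split; apply: expdecay_le (expdecay0 R) => t _;
  rewrite (_ : map_mx _ _ = 0) ?mulmx0 ?mxE//; apply/matrixP => p q; rewrite !mxE.
Qed.

Lemma is_derive_expmx_mulmx A X i j (t : R) :
  is_derive t 1 (fun s => (expmx (s *: A) *m X) i j)
    ((expmx (t *: A) *m (A *m X)) i j).
Proof.
have := is_derive_mulmx (is_derive_expmx A t) (is_derive_cst X t 1).
by rewrite mulmx0 addr0 expmx_comm -mulmxA => /is_derive_mxP; exact.
Qed.

Lemma expmx_decay_shift A z M : complex.Re z < 0 ->
  expmx_decay A ((toC A - z%:M) *m M) -> expmx_decay A M.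
Proof.
move=> z0 dM i j; have [] := dM i j; rewrite Re_mulmx_shift Im_mulmx_shift.
move=> dRe dIm.
apply: (expdecay_linear_ode (b := complex.Im z) z0 _ _ dRe dIm) => t.
  have := is_derive_expmx_mulmx A (reM M) i j t; congr (is_derive _ _ _ _).
  rewrite !mulmxDr mulmxN -!scalemxAr.
  by move: (expmx _ *m _) (_ *m reM M) (_ *m imM M) => AX X Y; rewrite !mxE; ring.
have := is_derive_expmx_mulmx A (imM M) i j t; congr (is_derive _ _ _ _).
rewrite !mulmxDr !mulmxN -!scalemxAr.
by move: (expmx _ *m _) (_ *m reM M) (_ *m imM M) => AX X Y; rewrite !mxE; ring.
Qed.

Lemma expmx_decay_prod_shift A (s : seq R[i]) M :
  (forall z, z \in s -> complex.Re z < 0) ->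
  expmx_decay A (\prod_(z <- s) (toC A - z%:M) *m M) -> expmx_decay A M.
Proof.
elim: s => [|z s IH] s_lt0; first by rewrite big_nil mul1mx.
rewrite big_cons -mulmxE -mulmxA => /expmx_decay_shift dM; apply: IH.
  by move=> w ws; rewrite s_lt0// inE ws orbT.
by apply: dM; rewrite s_lt0 ?mem_head.
Qed.

End HurwitzMatrices.

Section HurwitzExponential.
Variable R : realType.

Lemma hurwitz_expdecay_entry k (A : 'M[R]_k) i j : hurwitz A ->
  expdecay (fun t => expmx (t *: A) i j).
Proof.
case: k A i j => [A []//|k A i j hA]; pose Ac := map_mx (real_complex R) A.
have [s sE] := closed_field_poly_normal (char_poly Ac).
rewrite (monicP (char_poly_monic Ac)) scale1r in sE.
have s_lt0 z : z \in s -> complex.Re z < 0.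
  by move=> zs; apply: (hurwitz_char_poly_root hA); rewrite sE root_prod_XsubC.
have prod0 : \prod_(z <- s) (Ac - z%:M) = 0.
  rewrite -(Cayley_Hamilton Ac) sE rmorph_prod/=; apply: eq_bigr => z _.
  by rewrite rmorphB/= horner_mx_X horner_mx_C.
have := @expmx_decay_prod_shift _ _ A s 1 s_lt0; rewrite -/Ac prod0 mul0mx.
move=> /(_ (@expmx_decay0 _ _ A) i j)[+ _]; congr expdecay; apply/funext => t.
rewrite (_ : map_mx _ _ = 1) ?mulmx1//.
by apply/matrixP => p q; rewrite !mxE; case: (p == q).
Qed.

Lemma hurwitz_expdecay_inorm k l (A : 'M[R]_k) (B : 'M[R]_(k, l)) : hurwitz A ->
  expdecay (fun t => inorm (expmx (t *: A) *m B)).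
Proof.
move=> hA; pose S t := \sum_i \sum_j `|expmx (t *: A) i j|.
apply: (expdecay_le (v := fun t => S t * inorm B)) => [t _|].
  rewrite !ger0_norm ?inorm_ge0//.
    by rewrite (le_trans (inorm_mulmx _ _))// ler_wpM2r ?inorm_ge0// inorm_le_sum.
  by rewrite mulr_ge0 ?inorm_ge0//; do 2![apply: sumr_ge0 => ? _].
have [e e0 [C SC]] : expdecay S.
  apply: expdecay_sum => i; apply: expdecay_sum => j.
  by apply: expdecay_le (hurwitz_expdecay_entry i j hA) => t _; rewrite normr_id.
exists e => //; exists (C * inorm B) => t t0.
rewrite mulrAC normrM [`|inorm B|]ger0_norm ?inorm_ge0//.
by rewrite ler_wpM2r ?inorm_ge0 ?SC.
Qed.

Lemma inj_unitmx n (A : 'M[R]_n) :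
  (forall x : 'cV[R]_n, A *m x = 0 -> x = 0) -> A \in unitmx.
Proof.
move=> A0; rewrite -unitmx_tr -row_free_unit; apply: inj_row_free => v vA.
apply: trmx_inj; rewrite trmx0; apply: A0; apply: trmx_inj.
by rewrite trmx_mul trmxK vA trmx0.
Qed.

Lemma hurwitz_unitmx k (A : 'M[R]_k) : hurwitz A -> A \in unitmx.
Proof.
move=> hA; apply: inj_unitmx => x Ax; apply/eqP/negPn/negP => x0.
have := hA 0 0 x 0; rewrite x0 mulmx0 Ax !scale0r subr0 addr0 ltxx.
by move=> /(_ isT erefl erefl).
Qed.

(* A vector fixed by [expmx (T *: A)] is fixed by all the powers of that matrix,
   which tend to 0. *)
Lemma hurwitz_PhiT_unitmx k (A : 'M[R]_k) (T : R) : hurwitz A -> 0 < T ->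
  PhiT A T \in unitmx.
Proof.
move=> hA T0; rewrite /PhiT unitmx_mul unitmx_inv hurwitz_unitmx//=.
apply: inj_unitmx => x; rewrite mulmxBl mul1mx => /eqP; rewrite subr_eq0 => /eqP Ex.
have ExN N : expmx ((N%:R * T) *: A) *m x = x.
  rewrite expmxMn; elim: N => [|N IH]; first by rewrite mul1mx.
  by rewrite exprSr -mulmxE -mulmxA Ex.
apply/eqP; rewrite -inorm_eq0 eq_le inorm_ge0 andbT.
have := expdecay_cvgn T0 (hurwitz_expdecay_inorm x hA).
rewrite (_ : (fun N => _) = fun=> inorm x); last by apply/funext => N; rewrite ExN.
by move=> /(cvg_unique _ (cvg_cst _)) ->.
Qed.

End HurwitzExponential.

Section ExponentialKernels.
Variables (R : realType) (k l : nat) (A : 'M[R]_k) (B : 'M[R]_(k, l)).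
Implicit Types (s t c : R).
Local Notation mu := (@lebesgue_measure R).

Lemma continuous_inorm_expmx :
  continuous (fun r : R => inorm (expmx (r *: A) *m B)).
Proof.
have cEB : continuous (fun r : R => expmx (r *: A) *m B).
  by apply: continuous_mulmx => r; [exact: continuous_expmx|exact: cvg_cst].
by move=> r; exact: continuous_comp (cEB r) (@inorm_continuous _ _ _ _).
Qed.

Lemma Linfloc_inorm_expmx_reflect t :
  Linfloc (fun r => inorm (expmx ((t - r) *: A) *m B)).
Proof.
apply: continuous_Linfloc.
exact: (@continuous_reflect _ _ (fun r => inorm (expmx (r *: A) *m B))
  t continuous_inorm_expmx).
Qed.

Lemma Rintegral_inorm_expmx_ge0 t :
  0 <= \int[mu]_(r in `[0, t]) inorm (expmx (r *: A) *m B).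
Proof. by apply: Rintegral_ge0 => r _; exact: inorm_ge0. Qed.

Lemma Rintegral_inorm_expmx_reflect s t : s <= t ->
  \int[mu]_(r in `[s, t]) inorm (expmx ((t - r) *: A) *m B) =
  \int[mu]_(r in `[0, t - s]) inorm (expmx (r *: A) *m B).
Proof.
by move=> st; rewrite (Rintegral_itv_reflect _ continuous_inorm_expmx)// subrr.
Qed.

Lemma le_Rintegral_inorm_expmx s t : 0 <= s -> s <= t ->
  \int[mu]_(r in `[0, s]) inorm (expmx (r *: A) *m B) <=
  \int[mu]_(r in `[0, t]) inorm (expmx (r *: A) *m B).
Proof.
move=> s0 st; have lE := continuous_Linfloc continuous_inorm_expmx.
rewrite [leRHS](Rintegral_itv_cat lE (lexx 0) s0 st) lerDl.
by apply: Rintegral_ge0 => r _; exact: inorm_ge0.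
Qed.

Lemma mxLinfloc_expmx_input (u : R -> 'cV[R]_l) t :
  mxLinfloc u -> mxLinfloc (fun r => expmx ((t - r) *: A) *m B *m u r).
Proof.
move=> lu; apply: mxLinflocM => //; apply: mxLinflocM; last exact: mxLinfloc_cst.
exact: mxLinfloc_expmx_reflect.
Qed.

Lemma inorm_vint_expmx_le (u : R -> 'cV[R]_l) c s t : mxLinfloc u ->
  0 <= s -> s <= t -> (forall r, s <= r <= t -> inorm (u r) <= c) ->
  inorm (vint (fun r => expmx ((t - r) *: A) *m B *m u r) s t) <=
  c * \int[mu]_(r in `[0, t - s]) inorm (expmx (r *: A) *m B).
Proof.
move=> lu s0 st uc; have lE := Linfloc_inorm_expmx_reflect t.
rewrite -Rintegral_inorm_expmx_reflect// -RintegralZl_itv//.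
apply: inorm_vint_le => //; [exact: mxLinfloc_expmx_input|exact: LinflocZ|].
move=> r rst; rewrite (le_trans (inorm_mulmx _ _))// mulrC.
by rewrite ler_wpM2r ?inorm_ge0// uc.
Qed.

End ExponentialKernels.

Section LinearSystems.
Variables (R : realType) (k p q : nat) (A : 'M[R]_k) (B : 'M[R]_(k, p)).
Variables (C : 'M[R]_(q, k)) (D : 'M[R]_(q, p)).
Local Notation H := (lti A B C D).
Implicit Types (u v : sgn R p) (t : R).

Lemma lti_causal u v t : (forall s, 0 <= s <= t -> u s = v s) ->
  0 <= t -> H u t = H v t.
Proof.
move=> uv t0; rewrite /lti uv ?t0 ?lexx//.
by congr (_ *m _ + _); apply: eq_vint => r /uv ->.
Qed.

Lemma ltiD u v t : mxLinfloc u -> mxLinfloc v ->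
  H (fun s => u s + v s) t = H u t + H v t.
Proof.
move=> lu lv; rewrite /lti [D *m (_ + _)]mulmxDr.
rewrite [RHS]addrACA -[C *m _ + C *m _]mulmxDr.
congr (_ *m _ + _); rewrite -vintD//; try exact: mxLinfloc_expmx_input.
by apply: eq_vint => r _; rewrite mulmxDr.
Qed.

Lemma ltiZ u (c : R) t : mxLinfloc u -> H (fun s => c *: u s) t = c *: H u t.
Proof.
move=> lu; rewrite /lti scalerDr -!scalemxAr; congr (_ + _).
rewrite scalemxAr; congr (_ *m _).
rewrite -mul_scalar_mx mulmx_vint//; last exact: mxLinfloc_expmx_input.
by apply: eq_vint => r _; rewrite mul_scalar_mx -scalemxAr.
Qed.

Lemma ltiB u v t : mxLinfloc u -> mxLinfloc v ->
  H (fun s => u s - v s) t = H u t - H v t.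
Proof.
move=> lu lv; rewrite -scaleN1r -ltiZ// -ltiD//; last exact: mxLinflocZ.
by congr (H _ t); apply/funext => s; rewrite scaleN1r.
Qed.

Lemma mxLinfloc_lti u : mxLinfloc u -> mxLinfloc (H u).
Proof.
move=> lu; apply: mxLinflocD; last exact: mxLinflocMl.
apply: mxLinflocMl; pose h r := expmx (- r *: A) *m B *m u r.
have lh : mxLinfloc h.
  by apply: eq_mxLinfloc (mxLinfloc_expmx_input A B 0 lu) => r _; rewrite sub0r.
apply: (eq_mxLinfloc (F := fun t => expmx (t *: A) *m vint h 0 t)).
  move=> t t0; rewrite mulmx_vint//; apply: eq_vint => r _.
  by rewrite /h !mulmxA -expmxD.
by apply: mxLinflocM; [exact: mxLinfloc_expmx|exact: mxLinfloc_vint].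
Qed.

Lemma lti_bounded : hurwitz A -> exists M, forall u, mxLinfloc u ->
  (forall s, 0 <= s -> inorm (u s) <= 1) ->
  forall t, 0 <= t -> inorm (H u t) <= M.
Proof.
move=> hA; have [M EM] := expdecay_Rintegral_le (@continuous_inorm_expmx _ _ _ A B)
  (hurwitz_expdecay_inorm B hA).
exists (inorm C * M + inorm D) => u lu u1 t t0.
rewrite (le_trans (inormD _ _))// lerD//; last first.
  by rewrite (le_trans (inorm_mulmx _ _))// ler_piMr ?inorm_ge0 ?u1.
rewrite (le_trans (inorm_mulmx _ _))// ler_wpM2l ?inorm_ge0//.
apply: le_trans (EM t t0); rewrite -[X in `[0, X]]subr0.
under [leRHS]eq_Rintegral do rewrite ger0_norm ?inorm_ge0//.
rewrite -[leRHS]mul1r; apply: inorm_vint_expmx_le => // r /andP[r0 _].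
exact: u1.
Qed.

(* [C (s - A)^-1 B] applied to [s z] is [C B + C A (s - A)^-1 B] applied to [z]. *)
Lemma lti_primitive z w t : mxLinfloc w -> mxprimitive z w -> z 0 = 0 ->
  0 <= t -> lti A B C 0 w t = lti A (A *m B) C (C *m B) z t.
Proof.
move=> lw zw z0 t0; have lz := mxprimitive_mxLinfloc lw zw.
pose E r := expmx ((t - r) *: A).
have lE : mxLinfloc E by exact: mxLinfloc_expmx_reflect.
have EBz : mxprimitive (fun r => E r *m (B *m z r))
    (fun r => - (A *m E r) *m (B *m z r) + E r *m (B *m w r)).
  apply: mxprimitiveM.
  - exact/mxLinflocN/mxLinflocMl.
  - exact: mxLinflocMl.
  - exact: mxprimitive_expmx_reflect.
  - exact: mxprimitiveMl.
rewrite /lti mul0mx addr0 -mulmxA -mulmxDr; congr (C *m _).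
have := mxprimitiveE EBz (lexx 0) t0.
rewrite z0 !mulmx0 add0r /E subrr expmx0 mul1mx => ->.
have lEAB := mxLinfloc_expmx_input A (A *m B) t lz.
rewrite -vintD//; last first.
  apply: mxLinflocD; apply: mxLinflocM.
  - exact/mxLinflocN/mxLinflocMl.
  - exact: mxLinflocMl.
  - exact: mxLinfloc_expmx_reflect.
  - exact: mxLinflocMl.
by apply: eq_vint => r _; rewrite expmx_comm mulNmx !mulmxA addNKr.
Qed.

End LinearSystems.

Section StableOperators.
Variable R : realType.

(* What it takes for [L1norm F] to be finite and to bound [F u] on [[0, t]] in
   terms of [u] on [[0, t]] only. *)
Record stable_op p q (F : sgn R p -> sgn R q) : Prop := StableOp {
  stable_causal : forall u v t, (forall s, 0 <= s <= t -> u s = v s) ->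
    0 <= t -> F u t = F v t;
  stable_homogeneous : forall u c t, mxLinfloc u -> 0 <= t ->
    F (fun s => c *: u s) t = c *: F u t;
  stable_mxLinfloc : forall u, mxLinfloc u -> mxLinfloc (F u);
  stable_bounded : exists M, forall u, mxLinfloc u ->
    (forall s, 0 <= s -> inorm (u s) <= 1) ->
    forall t, 0 <= t -> inorm (F u t) <= M }.

Lemma stable_lti k p q (A : 'M[R]_k) (B : 'M[R]_(k, p)) (C : 'M[R]_(q, k))
  (D : 'M[R]_(q, p)) : hurwitz A -> stable_op (lti A B C D).
Proof.
move=> hA; split; [exact: lti_causal| |exact: mxLinfloc_lti|exact: lti_bounded].
by move=> u c t lu _; exact: ltiZ.
Qed.

Lemma stable_comp p q r (F : sgn R q -> sgn R r) (G : sgn R p -> sgn R q) :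
  stable_op F -> stable_op G -> stable_op (fun u => F (G u)).
Proof.
move=> [Fcausal Fhom Floc [M FM]] [Gcausal Ghom Gloc [N GN]]; split.
- move=> u v t uv t0; apply: Fcausal => // s /andP[s0 st].
  by apply: Gcausal => // x /andP[x0 xs]; rewrite uv// x0 (le_trans xs).
- move=> u c t lu t0; rewrite -Fhom//; last exact: Gloc.
  by apply: Fcausal => // s /andP[s0 _]; exact: Ghom.
- by move=> u /Gloc/Floc.
pose c := `|N| + 1; have c0 : 0 < c by rewrite ltr_wpDl.
exists (c * M) => u lu u1 t t0; have lGu := Gloc u lu.
have -> : F (G u) t = c *: F (fun s => c^-1 *: G u s) t.
  by rewrite Fhom ?scalerA ?divff ?scale1r ?gt_eqF.
rewrite inormZ gtr0_norm// ler_wpM2l ?(ltW c0)//.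
apply: FM => //; first exact: mxLinflocZ.
move=> s s0; rewrite inormZ gtr0_norm ?invr_gt0// mulrC ler_pdivrMr// mul1r.
by rewrite (le_trans (GN u lu u1 s s0))// (le_trans (ler_norm _))// lerDl.
Qed.

Lemma stable_idB p (F : sgn R p -> sgn R p) :
  stable_op F -> stable_op (fun u t => u t - F u t).
Proof.
move=> [Fcausal Fhom Floc [M FM]]; split.
- by move=> u v t uv t0; rewrite (Fcausal u v)// uv// t0 lexx.
- by move=> u c t lu t0; rewrite Fhom// scalerBr.
- by move=> u lu; apply: mxLinflocB => //; exact: Floc.
- exists (1 + M) => u lu u1 t t0.
  by rewrite (le_trans (inormB _ _))// lerD ?u1 ?FM.
Qed.

Lemma unit_input_mxLinfloc p (u : sgn R p) : unit_input u -> mxLinfloc u.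
Proof.
move=> [mu_ u1] i j b; rewrite (ord1 j); split; first exact: measurable_funTS.
by exists 1 => t /andP[t0 _]; rewrite (le_trans (inorm_col_ge _ _))// u1.
Qed.

Definition cutoff p (t : R) (u : sgn R p) : sgn R p :=
  fun s => if 0 <= s <= t then u s else 0.

Lemma unit_input_cutoff p (u : sgn R p) t : mxLinfloc u ->
  (forall s, 0 <= s <= t -> inorm (u s) <= 1) -> unit_input (cutoff t u).
Proof.
move=> lu u1; split=> [i|s _]; last first.
  by rewrite /cutoff; case: ifP => [/u1//|_]; rewrite inorm0.
rewrite (_ : (fun s => _) = (fun s => u s i 0) \_ `[0, t]).
  by have [mu_ _] := lu i 0 t; exact/(iffLR (measurable_restrictT _ _)).
apply/funext => s; rewrite patchE /cutoff mem_setE in_itv/=.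
by case: ifP => _; rewrite ?mxE.
Qed.

Lemma unit_input_le_L1norm p q (F : sgn R p -> sgn R q) (u : sgn R p) t :
  stable_op F -> unit_input u -> 0 <= t -> inorm (F u t) <= L1norm F.
Proof.
move=> [_ _ _ [M FM]] uu t0.
have Fv_le v : unit_input v ->
    ubound [set inorm (F v s) | s in [set s : R | 0 <= s]] M.
  move=> uv _ [s /= s0 <-]; apply: FM => //; last by case: uv.
  exact: unit_input_mxLinfloc.
apply: (@le_trans _ _ (Linf (F u))).
  by apply: ub_le_sup; [exists M; exact: Fv_le|exists t].
apply: ub_le_sup; last by exists u.
exists M => _ [v uv <-]; apply: ge_sup; last exact: Fv_le.
by exists (inorm (F v 0)), 0 => /=.
Qed.

(* By causality and homogeneity, the input may be cut off after [t] and rescaled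
   to an admissible unit input. *)
Lemma inorm_le_L1norm p q (F : sgn R p -> sgn R q) (u : sgn R p) (c t : R) :
  stable_op F -> mxLinfloc u -> 0 <= t ->
  (forall s, 0 <= s <= t -> inorm (u s) <= c) ->
  inorm (F u t) <= L1norm F * c.
Proof.
move=> sF lu t0 uc; have [Fcausal Fhom _ _] := sF.
have c0 : 0 <= c by apply: le_trans (uc 0 _); rewrite ?inorm_ge0 ?lexx.
pose w s := c^-1 *: u s; have lw : mxLinfloc w by exact: mxLinflocZ.
have uw : unit_input (cutoff t w).
  apply: unit_input_cutoff => // s st; rewrite inormZ normfV ger0_norm// mulrC.
  have [->|cN0] := eqVneq c 0; first by rewrite invr0 mulr0.
  by rewrite ler_pdivrMr ?lt_def ?cN0// mul1r uc.
have -> : F u t = c *: F (cutoff t w) t.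
  rewrite -Fhom//; last exact: unit_input_mxLinfloc.
  apply: Fcausal => // s st; rewrite /cutoff st scalerA.
  have [c_eq0|cN0] := eqVneq c 0; last by rewrite divff// scale1r.
  rewrite c_eq0 mul0r scale0r; apply/eqP.
  by rewrite -inorm_eq0 eq_le inorm_ge0 andbT -c_eq0 uc.
by rewrite inormZ ger0_norm// mulrC ler_wpM2r// unit_input_le_L1norm.
Qed.

Lemma L1norm_ge0 p q (F : sgn R p -> sgn R q) : stable_op F -> 0 <= L1norm F.
Proof.
move=> sF; have unit0 : unit_input (fun=> 0 : 'cV[R]_p).
  by split=> [i|t _]; [exact: measurable_cst|rewrite inorm0].
exact: le_trans (inorm_ge0 _) (unit_input_le_L1norm sF unit0 (lexx 0)).
Qed.

End StableOperators.

Section SignalRegularity.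
Variable R : realType.
Implicit Types (a b t : R).

Lemma within_coord_continuous m n (F : R -> 'M[R]_(m, n)) (D : set R) i j :
  {within D, continuous F} -> {within D, continuous (fun t => F t i j)}.
Proof.
move=> cF t; apply: (@continuous_comp (subspace D) _ _ F (fun M => M i j) t (cF t)).
exact: coord_continuous.
Qed.

Lemma within_mxLinfloc m n (F : R -> 'M[R]_(m, n)) :
  {within [set t : R | 0 <= t], continuous F} -> mxLinfloc F.
Proof.
move=> cF i j; apply: within_continuous_Linfloc => b _.
by apply: within_ge0_itv => //; exact: within_coord_continuous.
Qed.

Lemma within_inorm_continuous m n (F : R -> 'M[R]_(m, n)) (D : set R) :
  {within D, continuous F} -> {within D, continuous (fun t => inorm (F t))}.
Proof.
move=> cF t; apply: (@continuous_comp (subspace D) _ _ F (@inorm R m n) t (cF t)).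
exact: inorm_continuous.
Qed.

Definition f_consts_compact n m (f : R -> 'cV[R]_n -> 'cV[R]_m) :=
  forall Z : set 'cV[R]_n, compact Z ->
    exists L l b : 'I_m -> R, f_consts f Z L l b.

Lemma feedback_mxLinfloc n m (f : R -> 'cV[R]_n -> 'cV[R]_m) (x : sgn R n) :
  {within [set t : R | 0 <= t], continuous x} ->
  f_consts_compact f -> mxLinfloc (fun t => f t (x t)).
Proof.
move=> cx f_lip j j0; rewrite (ord1 j0) => {j0}.
apply: within_continuous_Linfloc => b _.
have {}cx := within_ge0_itv (b := b) (lexx 0) cx.
have [L [l [_ [fL _]]]] :=
  f_lip _ (continuous_compact cx (@segment_compact R 0 b)).
apply/subspace_continuousP => t tb.
pose h s := L j * inorm (x t - x s) + l j * `|t - s|.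
have h0 : h s @[s --> within `[0, b] (nbhs t)] --> (0 : R).
  rewrite -[X in _ --> X](_ : L j * inorm (x t - x t) + l j * `|t - t| = 0).
    apply: cvgD; apply: cvgM; try exact: cvg_cst.
      apply: (cvg_comp (fun s => x t - x s) (@inorm R n 1)); last first.
        exact: inorm_continuous.
      apply: cvgB; first exact: cvg_cst.
      by have /subspace_continuousP := cx; exact.
    apply: cvg_norm; apply: cvgB; first exact: cvg_cst.
    exact: cvg_within_filter cvg_id.
  by rewrite !subrr inorm0 normr0 !mulr0 addr0.
apply/cvgrPdist_lt => e e0; have /cvgrPdist_lt/(_ e e0) := h0.
rewrite !near_withinE; apply: filterS => s hs sb; apply: le_lt_trans (hs sb).
rewrite sub0r normrN (le_trans _ (ler_norm _))//.
move: (tb) (sb); rewrite /= !in_itv/= => /andP[t0 _] /andP[s0 _].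
exact: (fL j t s _ _ t0 s0 (imageP _ tb) (imageP _ sb)).
Qed.

Lemma finite_discontinuities_measurable (g : R -> R) (s : seq R) a b :
  (forall t, a < t < b -> t \notin s -> {for t, continuous g}) ->
  measurable_fun `[a, b] g.
Proof.
move=> gc; pose U := `]a, b[%classic `\` [set` s]; pose V := [set` [:: a, b & s]].
have measurable_subV W : W `<=` V -> measurable W.
  move=> WV; apply: countable_measurable => //.
  by apply/finite_set_countable/(sub_finite_set WV); exact: finite_seq.
have oU : open U.
  rewrite /U setDE; apply: openI; first exact: interval_open.
  apply: closed_openC; apply: compact_closed; first exact: norm_hausdorff.
  by apply: finite_compact; exact: finite_seq.
apply: (@measurable_funS _ _ _ _ (U `|` V)).
- by apply: measurableU; [exact: open_measurable|exact: measurable_subV].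
- move=> t /=; rewrite in_itv/= => /andP[a_t tb].
  have [tV|tV] := boolP (t \in [:: a, b & s]); [by right|left].
  move: tV; rewrite !inE !negb_or => /and3P[ta tNb /negP ts]; split=> //=.
  by rewrite in_itv/= !lt_neqAle eq_sym ta a_t tNb tb.
apply/measurable_funU => //; [exact: open_measurable|exact: measurable_subV|split].
  apply: open_continuous_measurable_fun => // t; rewrite inE => -[/=].
  by rewrite in_itv/= => atb /negP; exact: gc.
by move=> _ Y mY; apply: measurable_subV; exact: subIsetl.
Qed.

Lemma pw_cont_mxLinfloc k (v : sgn R k) :
  bounded_sig v -> pw_cont v -> mxLinfloc v.
Proof.
move=> [M vM] cv i j b; rewrite (ord1 j); split; last first.
  by exists M => t /andP[t0 _]; rewrite (le_trans (inorm_col_ge _ _))// vM.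
have b0 : 0 < `|b| + 1 by rewrite ltr_wpDl.
have [s [sc _]] := cv i _ b0.
apply: measurable_funS (finite_discontinuities_measurable sc) => //.
by apply: subset_itvl; rewrite bnd_simp (le_trans (ler_norm _))// lerDl.
Qed.

Lemma sampling_interval (T t : R) : 0 < T -> 0 <= t ->
  exists i : nat, i%:R * T <= t < i.+1%:R * T.
Proof.
move=> T0 t0; exists (Num.truncn (t / T)).
have /truncn_itv : 0 <= t / T by rewrite divr_ge0// ltW.
by rewrite ler_pdivlMr// ltr_pdivrMr.
Qed.

Lemma sampled_Linfloc (u : R -> R) (T : R) : 0 < T ->
  (forall (i : nat) t, i%:R * T <= t < i.+1%:R * T -> u t = u (i%:R * T)) ->
  Linfloc u.
Proof.
move=> T0 u_cst b.
split.
  apply: (@measurable_funS _ _ _ _ (\bigcup_i `[i%:R * T, i.+1%:R * T[%classic)).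
  - exact: bigcup_measurable.
  - move=> t /=; rewrite in_itv/= => /andP[t0 _].
    have [i it] := sampling_interval T0 t0.
    by exists i => //=; rewrite in_itv.
  apply/measurable_fun_bigcup => // i.
  apply: eq_measurable_fun (measurable_cst (u (i%:R * T))) => t.
  by rewrite inE/= in_itv/= => /u_cst ->.
have [N bN] : exists N : nat, b < N%:R * T.
  by exists (Num.truncn (b / T)).+1; rewrite -ltr_pdivrMr// truncnS_gt.
exists (\sum_(i < N) `|u (i%:R * T)|) => t /andP[t0 tb].
have [i it] := sampling_interval T0 t0.
have iN : (i < N)%N.
  rewrite -(ltr_nat R) -(ltr_pM2r T0); case/andP: it => it _.
  exact: le_lt_trans it (le_lt_trans tb bN).
by rewrite (u_cst i)// (bigD1 (Ordinal iN))//= lerDl sumr_ge0.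
Qed.

End SignalRegularity.

Section Filter.
Variable R : realType.

Lemma hurwitz_oppKf m (kf : 'I_m -> R) : (forall j, 0 < kf j) -> hurwitz (- Kf kf).
Proof.
move=> kf0 a b x y; rewrite -negb_and => xy0 /colP Ax /colP Ay.
have xE i : - kf i * x i 0 = a * x i 0 - b * y i 0.
  by have := Ax i; rewrite mulNmx /Kf mul_diag_mx !mxE => <-; rewrite mulNr.
have yE i : - kf i * y i 0 = b * x i 0 + a * y i 0.
  by have := Ay i; rewrite mulNmx /Kf mul_diag_mx !mxE => <-; rewrite mulNr.
rewrite ltNge; apply: contra xy0 => a0.
have xy i : x i 0 = 0 /\ y i 0 = 0.
  have : (kf i + a) * (x i 0 ^+ 2 + y i 0 ^+ 2) = 0.
    rewrite (_ : _ * _ = - (x i 0 * (- kf i * x i 0 - (a * x i 0 - b * y i 0)) +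
      y i 0 * (- kf i * y i 0 - (b * x i 0 + a * y i 0)))); last by ring.
    by rewrite xE yE !subrr !mulr0 addr0 oppr0.
  move/eqP; rewrite mulf_eq0 gt_eqF ?ltr_pwDl//= paddr_eq0 ?sqr_ge0//.
  by rewrite !sqrf_eq0 => /andP[/eqP ? /eqP].
by apply/andP; split; apply/eqP/colP => i; rewrite mxE; have [] := xy i.
Qed.

Lemma mul_pinv_row_mx m p (B : 'M[R]_(m + p, m)) (Bp : 'M[R]_(m + p, p)) :
  Bp^T *m B = 0 -> row_mx B Bp \in unitmx ->
  pinv B *m B = 1%:M /\ pinv B *m Bp = 0.
Proof.
move=> BpB uB.
have BBp : B^T *m Bp = 0 by apply: trmx_inj; rewrite trmx_mul trmxK BpB trmx0.
have uBB : B^T *m B \in unitmx.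
  have : (row_mx B Bp)^T *m row_mx B Bp \in unitmx.
    by rewrite unitmx_mul unitmx_tr uB.
  rewrite tr_row_mx mul_col_row BBp BpB unitmxE det_ublock unitrM.
  by case/andP.
by rewrite /pinv -!mulmxA BBp mulmx0 mulVmx.
Qed.

(* [C(s) B^+ (s - Ae) = (s C(s)) B^+ - C(s) B^+ Ae], where [s C(s)] is
   [K - K (s + K)^-1 K] for [K = Kf kf]. *)
Lemma CBsAeE n m (B : 'M[R]_(n, m)) (Ae : 'M[R]_n) (kf : 'I_m -> R)
    (e : sgn R n) (t : R) : mxLinfloc e ->
  CBsAe B Ae kf e t =
  lti (- Kf kf) (- Kf kf *m Kf kf) 1 (Kf kf) (fun s => pinv B *m e s) t -
  filt kf (fun s => pinv B *m Ae *m e s) t.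
Proof.
move=> loc_e; rewrite /CBsAe /filt /lti; set K := Kf kf; set P := pinv B.
pose Ku (M : 'M[R]_m) (u : sgn R m) r := expmx ((t - r) *: - K) *m M *m u r.
pose Pe s := P *m e s; pose PAe s := P *m Ae *m e s.
have lPe : mxLinfloc Pe by exact: mxLinflocMl.
have lPAe : mxLinfloc PAe by exact: mxLinflocMl.
have -> : vint (fun r => expmx ((t - r) *: - K) *m
      (K *m (K *m P + P *m Ae)) *m e r) 0 t =
    vint (Ku K PAe) 0 t - vint (Ku (- K *m K) Pe) 0 t.
  rewrite -vintB//; try exact: mxLinfloc_expmx_input.
  apply: eq_vint => r _; rewrite /Ku /Pe /PAe !mulmxDr mulmxDl.
  by rewrite !(mulmxN, mulNmx) opprK addrC !mulmxA.
by rewrite mulNmx !mul1mx mul0mx addr0 opprB addrAC mulmxA.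
Qed.

Lemma filt_prediction_error m p (B : 'M[R]_(m + p, m)) (Bp : 'M[R]_(m + p, p))
    (Ae : 'M[R]_(m + p)) (kf : 'I_m -> R) (e sh : sgn R (m + p)) (g : sgn R m)
    (t : R) :
  Bp^T *m B = 0 -> row_mx B Bp \in unitmx ->
  mxLinfloc e -> mxLinfloc sh -> mxLinfloc g ->
  mxprimitive e (fun s => Ae *m e s + (row_mx B Bp *m sh s - B *m g s)) ->
  e 0 = 0 -> 0 <= t ->
  filt kf (fun s => usubmx (sh s) - g s) t = CBsAe B Ae kf e t.
Proof.
move=> BpB uB loc_e loc_sh loc_g e_prim e0 t0; set P := pinv B.
have [PB PBp] := mul_pinv_row_mx BpB uB.
have lPAe : mxLinfloc (fun s => P *m Ae *m e s) by exact: mxLinflocMl.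
have lw : mxLinfloc (fun s => usubmx (sh s) - g s).
  by apply: mxLinflocB => //; exact: mxLinfloc_usubmx.
have Pe_prim : mxprimitive (fun s => P *m e s)
    (fun s => P *m Ae *m e s + (usubmx (sh s) - g s)).
  apply: eq_mxprimitive (mxprimitiveMl P _ e_prim) => [s _|]; last first.
    by apply: mxLinflocD; [|apply: mxLinflocB]; exact: mxLinflocMl.
  rewrite mulmxDr mulmxBr !mulmxA mul_mx_row PB PBp mul1mx.
  by rewrite -{1}[sh s]vsubmxK mul_row_col mul1mx mul0mx addr0.
have Pe0 : P *m e 0 = 0 by rewrite e0 mulmx0.
have := lti_primitive (- Kf kf) (Kf kf) 1 (mxLinflocD lPAe lw) Pe_prim Pe0 t0.
rewrite CBsAeE// mul1mx => <-.
by rewrite /filt [X in _ = X - _]ltiD// addrC addKr.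
Qed.

End Filter.

Section AdaptationGains.
Variables (R : realType) (n : nat) (A : 'M[R]_n).
Implicit Types (s t T : R).
Local Notation mu := (@lebesgue_measure R).

Lemma vint_expmx s t (y : 'cV[R]_n) : A \in unitmx -> 0 <= s -> s <= t ->
  vint (fun r => expmx ((t - r) *: A) *m y) s t = PhiT A (t - s) *m y.
Proof. by move=> uA s0 st; rewrite /PhiT -mulmxA -mulmx_vint_expmx// mulKmx. Qed.

Lemma alpha0E m (B : 'M[R]_(n, m)) T : 0 <= T ->
  alpha0 A B T = \int[mu]_(r in `[0, T]) inorm (expmx (r *: A) *m B).
Proof. by move=> /(Rintegral_inorm_expmx_reflect A B); rewrite subr0. Qed.

Lemma alpha0_ge0 m (B : 'M[R]_(n, m)) T : 0 <= T -> 0 <= alpha0 A B T.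
Proof. by move=> T0; rewrite alpha0E// Rintegral_inorm_expmx_ge0. Qed.

Lemma inorm_expmx_le_alpha1 T t : 0 <= t <= T ->
  inorm (expmx (t *: A)) <= alpha1 A T.
Proof.
move=> tT; rewrite /alpha1; apply: ub_le_sup; last first.
  by exists t => //=; rewrite in_itv.
have [_ [M EM]] := continuous_Linfloc (@continuous_inorm_expmx _ _ _ A 1) T.
exists M => _ [s /= + <-]; rewrite in_itv/= => /EM.
by rewrite mulmx1 ger0_norm ?inorm_ge0.
Qed.

Lemma Rintegral_inorm_expmx_le_alpha2 T t : 0 <= t <= T ->
  \int[mu]_(r in `[0, t])
    inorm (expmx (r *: A) *m (invmx (PhiT A T) *m expmx (T *: A))) <= alpha2 A T.
Proof.
set M := _ *m _ => tT.
have reflectE s : 0 <= s -> \int[mu]_(r in `[0, s])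
    inorm (expmx ((s - r) *: A) *m invmx (PhiT A T) *m expmx (T *: A)) =
    \int[mu]_(r in `[0, s]) inorm (expmx (r *: A) *m M).
  move=> s0; have := Rintegral_inorm_expmx_reflect A M s0; rewrite subr0 => <-.
  by apply: eq_Rintegral => r _; rewrite mulmxA.
case/andP: (tT) => t0 _; rewrite -reflectE// /alpha2; apply: ub_le_sup; last first.
  by exists t => //=; rewrite in_itv.
exists (\int[mu]_(r in `[0, T]) inorm (expmx (r *: A) *m M)) => _ [s /= + <-].
by rewrite in_itv/= => /andP[s0 sT]; rewrite reflectE// le_Rintegral_inorm_expmx.
Qed.

End AdaptationGains.

Section PredictionError.
Variables (R : realType) (n m : nat) (Ae : 'M[R]_n) (B : 'M[R]_(n, m)) (T bf : R).
Variables (e sigma : sgn R n) (g : sgn R m) (t : R).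
Hypotheses (hAe : hurwitz Ae) (T0 : 0 < T) (t0 : 0 <= t).
Hypotheses (loc_e : mxLinfloc e) (loc_sigma : mxLinfloc sigma) (loc_g : mxLinfloc g).
Hypothesis e_prim : mxprimitive e (fun s => Ae *m e s + (sigma s - B *m g s)).
Hypothesis e0 : e 0 = 0.
Hypothesis sigmaE : forall (i : nat) s, i%:R * T <= s < i.+1%:R * T ->
  sigma s = - (invmx (PhiT Ae T) *m expmx (T *: Ae) *m e (i%:R * T)).
Hypothesis g_le : forall s, 0 <= s <= t -> inorm (g s) <= bf.

Let bf0 : 0 <= bf.
Proof. by apply: le_trans (g_le (s := 0) _); rewrite ?inorm_ge0 ?lexx. Qed.

Lemma prediction_error_voc (a s : R) : 0 <= a -> a <= s ->
  e s = expmx ((s - a) *: Ae) *m e a +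
    (vint (fun r => expmx ((s - r) *: Ae) *m sigma r) a s -
     vint (fun r => expmx ((s - r) *: Ae) *m B *m g r) a s).
Proof.
move=> a0 a_s; rewrite -vintB//; last 2 first.
- by apply: mxLinflocM; first exact: mxLinfloc_expmx_reflect.
- exact: mxLinfloc_expmx_input.
rewrite (variation_of_constants loc_e _ e_prim a0 a_s).
  by congr (_ + _); apply: eq_vint => r _; rewrite mulmxBr mulmxA.
by apply: mxLinflocB => //; exact: mxLinflocMl.
Qed.

Lemma inorm_vint_disturbance_le (a s : R) : 0 <= a -> a <= s -> s <= t ->
  s <= a + T ->
  inorm (vint (fun r => expmx ((s - r) *: Ae) *m B *m g r) a s) <=
  bf * alpha0 Ae B T.
Proof.
move=> a0 a_s st s_aT; rewrite alpha0E; last exact: ltW.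
apply: le_trans (_ : _ <= bf *
    \int[lebesgue_measure]_(r in `[0, s - a]) inorm (expmx (r *: Ae) *m B)) _.
  apply: inorm_vint_expmx_le => // r /andP[ar rs].
  by rewrite g_le// (le_trans a0 ar) (le_trans rs).
rewrite ler_wpM2l//; apply: le_Rintegral_inorm_expmx; first by rewrite subr_ge0.
by rewrite lerBlDl.
Qed.

(* The adaptive law is chosen so that, over one sampling period, [sigma] cancels
   the free response of the prediction error. *)
Lemma prediction_error_sample (i : nat) : i%:R * T <= t ->
  inorm (e (i%:R * T)) <= bf * alpha0 Ae B T.
Proof.
case: i => [_|i it].
  by rewrite mul0r e0 inorm0 mulr_ge0// alpha0_ge0// ltW.
set a := i%:R * T; set b := i.+1%:R * T.
have a0 : 0 <= a by rewrite mulr_ge0// ltW.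
have ba : b - a = T by rewrite /b -natr1 mulrDl mul1r addrC addKr.
have ab : a <= b by rewrite -subr_ge0 ba ltW.
pose y := invmx (PhiT Ae T) *m (expmx (T *: Ae) *m e a).
have lE := mxLinfloc_expmx_reflect Ae b.
have sigma_resp : vint (fun r => expmx ((b - r) *: Ae) *m sigma r) a b =
    - (expmx (T *: Ae) *m e a).
  rewrite (@eq_vint_co _ _ _ (fun r => expmx ((b - r) *: Ae) *m - y))//.
  - rewrite vint_expmx ?hurwitz_unitmx// ba mulmxN mulKVmx//.
    exact: hurwitz_PhiT_unitmx.
  - exact: mxLinflocM.
  - by apply: mxLinflocM => //; exact: mxLinfloc_cst.
  - by move=> r rab; rewrite (sigmaE rab) /y -/a mulmxA.
rewrite (prediction_error_voc a0 ab) ba sigma_resp addrA subrr add0r inormN.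
by apply: inorm_vint_disturbance_le; rewrite // -lerBlDl ba.
Qed.

Lemma inorm_vint_correction_le (i : nat) : i%:R * T <= t < i.+1%:R * T ->
  inorm (vint (fun r => expmx ((t - r) *: Ae) *m sigma r) (i%:R * T) t) <=
  bf * alpha0 Ae B T * alpha2 Ae T.
Proof.
move=> /andP[it ti]; set a := i%:R * T; have a0 : 0 <= a by rewrite mulr_ge0// ltW.
pose M := invmx (PhiT Ae T) *m expmx (T *: Ae).
rewrite (@eq_vint _ _ _ (fun r => expmx ((t - r) *: Ae) *m M *m - e a)); last first.
  move=> r /andP[ar rt]; rewrite (sigmaE (i := i)) ?ar ?(le_lt_trans rt)//.
  by rewrite !mulmxN !mulmxA.
have taT : 0 <= t - a <= T.
  by rewrite subr_ge0 it lerBlDl -[X in _ + X]mul1r -mulrDl natr1 ltW.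
have ea0 : 0 <= bf * alpha0 Ae B T by rewrite mulr_ge0// alpha0_ge0// ltW.
rewrite (le_trans _ (ler_wpM2l ea0 (Rintegral_inorm_expmx_le_alpha2 Ae taT)))//.
apply: inorm_vint_expmx_le => // [|r _]; first exact: mxLinfloc_cst.
by rewrite inormN prediction_error_sample.
Qed.

Lemma inorm_prediction_error_le : inorm (e t) <= gamma0 Ae B T bf.
Proof.
have [i it] := sampling_interval T0 t0; case/andP: (it) => a_t t_lt.
set a := i%:R * T in a_t; have a0 : 0 <= a by rewrite mulr_ge0// ltW.
have t_aT : t <= a + T by rewrite -[X in _ + X]mul1r -mulrDl natr1 ltW.
rewrite (prediction_error_voc a0 a_t) /gamma0 !mulrDr mulr1 -addrA.
rewrite (le_trans (inormD _ _))// lerD//.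
  rewrite (le_trans (inorm_mulmx _ _))// mulrC ler_pM ?inorm_ge0//.
    exact: prediction_error_sample.
  by apply: inorm_expmx_le_alpha1; rewrite subr_ge0 a_t lerBlDl.
rewrite (le_trans (inormB _ _))// lerD//; first exact: inorm_vint_correction_le.
exact: inorm_vint_disturbance_le.
Qed.

End PredictionError.

Section Uncertainty.
Variables (R : realType) (n m : nat) (f : R -> 'cV[R]_n -> 'cV[R]_m).
Variables (Z : set 'cV[R]_n) (L l b : 'I_m -> R).
Hypothesis f_bounds : f_consts f Z L l b.

Lemma maxj_ge0 (c : 'I_m -> R) : 0 <= maxj c.
Proof. exact: bigmax_ge_id. Qed.

Lemma inorm_f_le_maxj (t : R) x : 0 <= t -> Z x -> inorm (f t x) <= maxj b.
Proof.
move=> t0 Zx; apply: inorm_col_le => [|j]; first exact: maxj_ge0.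
by have [_ fb] := f_bounds; apply: le_trans (fb j t x t0 Zx) (le_bigmax _ b j).
Qed.

Lemma inorm_fB_le_maxj (t : R) x z : 0 <= t -> Z x -> Z z ->
  inorm (f t x - f t z) <= maxj L * inorm (x - z).
Proof.
move=> t0 Zx Zz; apply: inorm_col_le => [|j].
  by rewrite mulr_ge0 ?inorm_ge0 ?maxj_ge0.
have [fL _] := f_bounds; rewrite !mxE (le_trans (fL j t t x z t0 t0 Zx Zz))//.
rewrite subrr normr0 mulr0 addr0 ler_wpM2r ?inorm_ge0//.
exact: (le_bigmax _ L).
Qed.

End Uncertainty.

Section PlantResponse.
Variables (R : realType) (n m : nat) (Am : 'M[R]_n) (B Bv : 'M[R]_(n, m)).
Implicit Types (x : sgn R n) (u v g : sgn R m) (t : R).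

Lemma HxmE (D : 'M[R]_(n, m)) u t :
  Hxm Am D u t = vint (fun r => expmx ((t - r) *: Am) *m (D *m u r)) 0 t.
Proof.
rewrite /Hxm /lti mul1mx mul0mx addr0.
by apply: eq_vint => r _; rewrite mulmxA.
Qed.

Lemma inorm_free_response_le (x0 : 'cV[R]_n) t : hurwitz Am -> 0 <= t ->
  inorm (expmx (t *: Am) *m x0) <= L1norm (sHm Am) * inorm x0.
Proof.
move=> hAm t0; have -> : expmx (t *: Am) *m x0 = sHm Am (fun=> x0) t.
  rewrite /sHm /lti mul1mx (@eq_vint _ _ _ (fun r => expmx ((t - r) *: Am) *m x0)).
    by rewrite mulmx_vint_expmx// subr0 mulmxBl mul1mx subrK.
  by move=> r _; rewrite mulmx1.
by apply: inorm_le_L1norm => //; [exact: stable_lti|exact: mxLinfloc_cst].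
Qed.

Definition plant_rate v x u g : sgn R n :=
  fun s => Am *m x s + Bv *m v s + B *m (u s + g s).

Lemma mxLinfloc_plant_rate v x u g : mxLinfloc v -> mxLinfloc x ->
  mxLinfloc u -> mxLinfloc g -> mxLinfloc (plant_rate v x u g).
Proof.
move=> lv lx lu lg; apply: mxLinflocD; last by apply/mxLinflocMl/mxLinflocD.
by apply: mxLinflocD; exact: mxLinflocMl.
Qed.

Lemma plant_response v x u g t : mxLinfloc v -> mxLinfloc x ->
  mxLinfloc u -> mxLinfloc g -> mxprimitive x (plant_rate v x u g) -> 0 <= t ->
  x t = expmx (t *: Am) *m x 0 + Hxm Am Bv v t +
        Hxm Am B (fun s => u s + g s) t.
Proof.
move=> lv lx lu lg x_prim t0; have lE := mxLinfloc_expmx_reflect Am t.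
have lBug : mxLinfloc (fun s => B *m (u s + g s)) by exact/mxLinflocMl/mxLinflocD.
have lBvv : mxLinfloc (fun s => Bv *m v s) by exact: mxLinflocMl.
rewrite (@variation_of_constants _ _ Am x
  (fun s => Bv *m v s + B *m (u s + g s)) 0 t)//.
- rewrite subr0 -addrA !HxmE -vintD//; try exact: mxLinflocM.
  by congr (_ + _); apply: eq_vint => s _; rewrite mulmxDr.
- exact: mxLinflocD.
- by apply: eq_mxprimitive x_prim => s _; rewrite addrA.
Qed.

End PlantResponse.

Section ReferenceSystem.
Variables (R : realType) (n m : nat).
Variables (Am : 'M[R]_n) (B Bv : 'M[R]_(n, m)) (kf : 'I_m -> R).
Variables (f : R -> 'cV[R]_n -> 'cV[R]_m) (v : sgn R m) (x0 : 'cV[R]_n).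
Variables (xr : sgn R n) (ur : sgn R m).
Hypotheses (hAm : hurwitz Am) (kf0 : forall j, 0 < kf j) (loc_v : mxLinfloc v).
Hypothesis f_lip : f_consts_compact f.
Hypothesis ref : ref_sol Am Bv B kf v f x0 xr ur.
Local Notation fr := (fun s => f s (xr s)).

Lemma stable_filt : stable_op (filt kf).
Proof. exact/stable_lti/hurwitz_oppKf. Qed.

Lemma stable_Hxm : stable_op (Hxm Am B).
Proof. exact: stable_lti. Qed.

Lemma stable_Gxm : stable_op (Gxm Am B kf).
Proof. exact: stable_comp stable_Hxm (stable_idB stable_filt). Qed.

Lemma ref_state_continuous : {within [set t : R | 0 <= t], continuous xr}.
Proof. by case: ref. Qed.

Lemma ref_state_init : xr 0 = x0.
Proof. by case: ref => _ [xrE _]; rewrite xrE// vintxx addr0. Qed.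

Lemma ref_state_mxLinfloc : mxLinfloc xr.
Proof. exact/within_mxLinfloc/ref_state_continuous. Qed.

Lemma ref_uncertainty_mxLinfloc : mxLinfloc fr.
Proof. exact: feedback_mxLinfloc ref_state_continuous f_lip. Qed.

Lemma ref_inputE t : 0 <= t -> ur t = - filt kf fr t.
Proof. by case: ref => _ [_]; exact. Qed.

Lemma ref_input_mxLinfloc : mxLinfloc ur.
Proof.
apply: eq_mxLinfloc (mxLinflocN (stable_mxLinfloc stable_filt
  ref_uncertainty_mxLinfloc)) => t t0.
by rewrite ref_inputE.
Qed.

Lemma ref_state_primitive : mxprimitive xr (plant_rate Am B Bv v xr ur fr).
Proof.
case: ref => _ [xrE _]; apply: vint_mxprimitive xrE.
by apply: mxLinfloc_plant_rate => //; [exact: ref_state_mxLinfloc|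
  exact: ref_input_mxLinfloc|exact: ref_uncertainty_mxLinfloc].
Qed.

Lemma ref_stateE t : 0 <= t ->
  xr t = expmx (t *: Am) *m x0 + Hxm Am Bv v t + Gxm Am B kf fr t.
Proof.
move=> t0; rewrite (plant_response loc_v ref_state_mxLinfloc ref_input_mxLinfloc
  ref_uncertainty_mxLinfloc ref_state_primitive t0) ref_state_init.
congr (_ + _); apply: lti_causal => // s /andP[s0 _].
by rewrite ref_inputE// addrC.
Qed.

Lemma ref_state_lt (rho rho_in vmax : R) (L l b : 'I_m -> R) :
  f_consts f (Omega rho) L l b ->
  L1norm (sHm Am) * inorm x0 <= rho_in ->
  (forall t, 0 <= t -> inorm (v t) <= vmax) ->
  L1norm (Gxm Am B kf) * maxj b < rho - L1norm (Hxm Am Bv) * vmax - rho_in ->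
  forall t, 0 <= t -> inorm (xr t) < rho.
Proof.
move=> f_rho x0_in v_le gain.
have free_le t : 0 <= t -> inorm (expmx (t *: Am) *m x0) <= rho_in.
  by move=> t0; exact: le_trans (inorm_free_response_le x0 hAm t0) x0_in.
have v_resp t : 0 <= t -> inorm (Hxm Am Bv v t) <= L1norm (Hxm Am Bv) * vmax.
  move=> t0; apply: inorm_le_L1norm => //; first exact: stable_lti.
  by move=> s /andP[s0 _]; exact: v_le.
apply: (continuous_barrier (h := fun t => inorm (xr t))) => [||t t0 xr_le].
- exact/within_inorm_continuous/ref_state_continuous.
- have := free_le 0 (lexx 0); rewrite expmx0 mul1mx ref_state_init.
  have := le_trans (inorm_ge0 _) (v_resp 0 (lexx 0)).
  have := mulr_ge0 (L1norm_ge0 stable_Gxm) (maxj_ge0 b).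
  lra.
have fr_resp : inorm (Gxm Am B kf fr t) <= L1norm (Gxm Am B kf) * maxj b.
  apply: inorm_le_L1norm => //; first exact: stable_Gxm.
    exact: ref_uncertainty_mxLinfloc.
  move=> s /[dup] st /andP[s0 _].
  by apply: (inorm_f_le_maxj f_rho) => //; exact: xr_le.
rewrite ref_stateE// (le_lt_trans (inormD _ _))//.
have := inormD (expmx (t *: Am) *m x0) (Hxm Am Bv v t).
have := free_le t t0; have := v_resp t t0; lra.
Qed.

Lemma inorm_ref_input_le (rho : R) (L l b : 'I_m -> R) t :
  f_consts f (Omega rho) L l b ->
  (forall s, 0 <= s -> inorm (xr s) <= rho) -> 0 <= t ->
  inorm (ur t) <= L1norm (filt kf) * maxj b.
Proof.
move=> f_rho xr_le t0; rewrite ref_inputE// inormN.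
apply: inorm_le_L1norm => //; first exact: stable_filt.
  exact: ref_uncertainty_mxLinfloc.
by move=> s /andP[s0 _]; apply: (inorm_f_le_maxj f_rho) => //; exact: xr_le.
Qed.

End ReferenceSystem.

Section AdaptiveSystem.
Variables (R : realType) (m p : nat).
Variables (Am Ae : 'M[R]_(m + p)) (B Bv : 'M[R]_(m + p, m)).
Variables (Bp : 'M[R]_(m + p, p)) (kf : 'I_m -> R) (T : R).
Variables (f : R -> 'cV[R]_(m + p) -> 'cV[R]_m) (v : sgn R m).
Variables (x0 : 'cV[R]_(m + p)) (x xh sh : sgn R (m + p)) (ua : sgn R m).
Hypotheses (hAm : hurwitz Am) (hAe : hurwitz Ae) (kf0 : forall j, 0 < kf j).
Hypotheses (BpB : Bp^T *m B = 0) (uB : row_mx B Bp \in unitmx) (T0 : 0 < T).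
Hypothesis loc_v : mxLinfloc v.
Hypothesis f_lip : f_consts_compact f.
Hypothesis adaptive : adaptive_sol Am Bv B Bp Ae kf T v f x0 x xh sh ua.
Local Notation fx := (fun s => f s (x s)).
Local Notation e := (fun s => xh s - x s).

Lemma adaptive_state_continuous : {within [set t : R | 0 <= t], continuous x}.
Proof. by case: adaptive. Qed.

Lemma adaptive_state_init : x 0 = x0.
Proof. by case: adaptive => _ [_ [xE _]]; rewrite xE// vintxx addr0. Qed.

Lemma prediction_error_init : xh 0 - x 0 = 0.
Proof.
case: adaptive => _ [_ [_ [xhE _]]].
by rewrite xhE// adaptive_state_init vintxx addr0 subrr.
Qed.

Lemma adaptive_state_mxLinfloc : mxLinfloc x.
Proof. exact/within_mxLinfloc/adaptive_state_continuous. Qed.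

Lemma prediction_error_mxLinfloc : mxLinfloc e.
Proof.
apply: mxLinflocB adaptive_state_mxLinfloc.
by case: adaptive => _ [+ _]; exact: within_mxLinfloc.
Qed.

Lemma adaptive_uncertainty_mxLinfloc : mxLinfloc fx.
Proof. exact: feedback_mxLinfloc adaptive_state_continuous f_lip. Qed.

Lemma estimateE (i : nat) t : i%:R * T <= t < i.+1%:R * T ->
  row_mx B Bp *m sh t =
  - (invmx (PhiT Ae T) *m expmx (T *: Ae) *m (xh (i%:R * T) - x (i%:R * T))).
Proof.
case: adaptive => _ [_ [_ [_ [shE _]]]] => it.
by rewrite (shE i)// mulmxN !mulmxA mulmxV// mul1mx.
Qed.

Lemma estimate_mxLinfloc : mxLinfloc sh.
Proof.
case: adaptive => _ [_ [_ [_ [shE _]]]] i j.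
apply: (sampled_Linfloc T0) => k t kt.
rewrite (shE k _ kt) (shE k (k%:R * T))//.
by rewrite lexx/= ltr_pM2r// ltr_nat ltnSn.
Qed.

Lemma adaptive_inputE t : 0 <= t -> ua t = - filt kf (fun s => usubmx (sh s)) t.
Proof. by case: adaptive => _ [_ [_ [_ [_]]]]; exact. Qed.

Lemma adaptive_input_mxLinfloc : mxLinfloc ua.
Proof.
apply: eq_mxLinfloc (mxLinflocN (stable_mxLinfloc (stable_filt kf0)
  (mxLinfloc_usubmx estimate_mxLinfloc))) => t t0.
by rewrite adaptive_inputE.
Qed.

Lemma mxLinfloc_adaptive_rate : mxLinfloc (plant_rate Am B Bv v x ua fx).
Proof.
by apply: mxLinfloc_plant_rate => //; [exact: adaptive_state_mxLinfloc|
  exact: adaptive_input_mxLinfloc|exact: adaptive_uncertainty_mxLinfloc].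
Qed.

Lemma adaptive_state_primitive : mxprimitive x (plant_rate Am B Bv v x ua fx).
Proof.
case: adaptive => _ [_ [xE _]].
exact: vint_mxprimitive mxLinfloc_adaptive_rate xE.
Qed.

Lemma prediction_error_primitive :
  mxprimitive e (fun s => Ae *m e s + (row_mx B Bp *m sh s - B *m fx s)).
Proof.
pose err_rate s := Ae *m e s + (row_mx B Bp *m sh s - B *m fx s).
have loc_err : mxLinfloc err_rate.
  apply: mxLinflocD; first exact/mxLinflocMl/prediction_error_mxLinfloc.
  by apply: mxLinflocB; apply: mxLinflocMl;
    [exact: estimate_mxLinfloc|exact: adaptive_uncertainty_mxLinfloc].
case: adaptive => _ [_ [xE [xhE _]]].
apply: (vint_mxprimitive (a := 0) loc_err) => t t0.
rewrite add0r xhE// xE// opprD addrACA subrr add0r.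
apply/eqP; rewrite subr_eq -vintD//; last exact: mxLinfloc_adaptive_rate.
apply/eqP/eq_vint => s _; rewrite /err_rate /plant_rate.
rewrite -[in row_mx _ _ *m _](vsubmxK (sh s)) mul_row_col ![B *m (_ + _)]mulmxDr.
by apply/matrixP => i j; rewrite !mxE; ring.
Qed.

Lemma inorm_adaptive_prediction_error_le (bf t : R) : 0 <= t ->
  (forall s, 0 <= s <= t -> inorm (f s (x s)) <= bf) ->
  inorm (xh t - x t) <= gamma0 Ae B T bf.
Proof.
move=> t0 fx_le; have loc_sigma := mxLinflocMl (row_mx B Bp) estimate_mxLinfloc.
exact: (inorm_prediction_error_le hAe T0 t0 prediction_error_mxLinfloc loc_sigma
  adaptive_uncertainty_mxLinfloc prediction_error_primitive prediction_error_init
  estimateE).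
Qed.

Section Tracking.
Variables (xr : sgn R (m + p)) (ur : sgn R m).
Hypothesis ref : ref_sol Am Bv B kf v f x0 xr ur.
Local Notation d := (fun s => f s (xr s) - f s (x s)).

Lemma uncertainty_error_mxLinfloc : mxLinfloc d.
Proof.
apply: mxLinflocB adaptive_uncertainty_mxLinfloc.
exact: ref_uncertainty_mxLinfloc f_lip ref.
Qed.

Lemma control_errorE t : 0 <= t ->
  ur t - ua t = CBsAe B Ae kf e t - filt kf d t.
Proof.
move=> t0.
rewrite -(filt_prediction_error kf BpB uB prediction_error_mxLinfloc
  estimate_mxLinfloc adaptive_uncertainty_mxLinfloc prediction_error_primitive
  prediction_error_init t0).
have loc_fx := adaptive_uncertainty_mxLinfloc.
have loc_fr := ref_uncertainty_mxLinfloc f_lip ref.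
have loc_s1 := mxLinfloc_usubmx estimate_mxLinfloc.
rewrite (ref_inputE ref)// adaptive_inputE// /filt !ltiB//.
by rewrite opprK opprB subrKA addrC.
Qed.

Lemma state_errorE t : 0 <= t ->
  xr t - x t = Gxm Am B kf d t + HxmCBsAe Am B Ae kf e t.
Proof.
move=> t0; have loc_d := uncertainty_error_mxLinfloc.
have loc_fx := adaptive_uncertainty_mxLinfloc.
have loc_ua := adaptive_input_mxLinfloc.
have loc_fr := ref_uncertainty_mxLinfloc f_lip ref.
have loc_ur := ref_input_mxLinfloc kf0 f_lip ref.
rewrite (plant_response loc_v (ref_state_mxLinfloc ref) loc_ur loc_fr
  (ref_state_primitive kf0 loc_v f_lip ref) t0).
rewrite (plant_response loc_v adaptive_state_mxLinfloc loc_ua loc_fx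
  adaptive_state_primitive t0).
rewrite (ref_state_init ref) adaptive_state_init opprD addrACA subrr add0r.
rewrite -ltiB; [|exact: mxLinflocD..].
rewrite /Gxm /HxmCBsAe -ltiD; last 2 first.
- by apply: mxLinflocB => //; exact: (stable_mxLinfloc (stable_filt kf0)).
- exact: mxLinfloc_lti prediction_error_mxLinfloc.
apply: lti_causal => // s /andP[s0 _].
by rewrite opprD addrACA control_errorE// addrC addrA addrAC.
Qed.

Lemma state_error_continuous :
  {within [set t : R | 0 <= t], continuous (fun s => inorm (xr s - x s))}.
Proof.
apply: (@within_inorm_continuous _ _ _ (fun s => xr s - x s)).
apply/subspace_continuousP => s s0; apply: cvgB; move: s s0.
  exact/subspace_continuousP/(ref_state_continuous ref).
exact/subspace_continuousP/adaptive_state_continuous.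
Qed.

Variables (rho_r gamma1 : R) (L l b : 'I_m -> R).
Hypothesis f_rho : f_consts f (Omega (rho_r + gamma1)) L l b.
Hypothesis xr_le : forall t, 0 <= t -> inorm (xr t) <= rho_r.
Hypothesis gamma1_gt0 : 0 < gamma1.
Local Notation g0 := (gamma0 Ae B T (maxj b)).

Lemma inorm_state_le t : 0 <= t -> inorm (xr t - x t) <= gamma1 ->
  inorm (x t) <= rho_r + gamma1.
Proof.
move=> t0 dt; rewrite -[x t](subKr (xr t)) (le_trans (inormB _ _))//.
by rewrite lerD// xr_le.
Qed.

Lemma inorm_uncertainty_error_le t : 0 <= t -> inorm (xr t - x t) <= gamma1 ->
  inorm (f t (xr t) - f t (x t)) <= maxj L * inorm (xr t - x t).
Proof.
move=> t0 dt; apply: (inorm_fB_le_maxj f_rho) => //; last exact: inorm_state_le.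
by rewrite /Omega/= (le_trans (xr_le t0))// lerDl ltW.
Qed.

Lemma inorm_tracking_prediction_error_le t : 0 <= t ->
  (forall s, 0 <= s <= t -> inorm (xr s - x s) <= gamma1) ->
  inorm (xh t - x t) <= g0.
Proof.
move=> t0 dt; apply: inorm_adaptive_prediction_error_le => //.
move=> s /[dup] st /andP[s0 _].
by apply: (inorm_f_le_maxj f_rho s0); apply: inorm_state_le => //; exact: dt.
Qed.

Hypothesis small_gain : L1norm (Gxm Am B kf) * maxj L < 1.

Lemma inorm_state_error_le t : 0 <= t ->
  (forall s, 0 <= s <= t -> inorm (xr s - x s) <= gamma1) ->
  inorm (xr t - x t) <=
  L1norm (HxmCBsAe Am B Ae kf) / (1 - L1norm (Gxm Am B kf) * maxj L) * g0.
Proof.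
(* Small gain: at the time [c] where [xr - x] is largest on [[0, t]], the
   contribution of the uncertainty is at most a fraction of [xr - x] itself. *)
move=> t0 dt.
have d_cont := within_ge0_itv (b := t) (lexx 0) state_error_continuous.
have [c] := EVT_max t0 d_cont; rewrite in_itv/= => /andP[c0 ct] d_max.
set S := inorm (xr c - x c).
have dS s : 0 <= s <= t -> inorm (xr s - x s) <= S.
  by move=> st; apply: d_max; rewrite in_itv.
apply: le_trans (dS t _) _; first by rewrite t0 lexx.
have dc s : 0 <= s <= c -> inorm (xr s - x s) <= gamma1.
  by move=> /andP[s0 sc]; apply: dt; rewrite s0 (le_trans sc).
have S_le : S <= L1norm (Gxm Am B kf) * (maxj L * S) +
    L1norm (HxmCBsAe Am B Ae kf) * g0.
  rewrite {1}/S state_errorE// (le_trans (inormD _ _))// lerD//.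
  - apply: inorm_le_L1norm => //; first exact: stable_Gxm.
      exact: uncertainty_error_mxLinfloc.
    move=> s /[dup] sc /andP[s0 s_c].
    rewrite (le_trans (inorm_uncertainty_error_le s0 (dc s sc)))//.
    by rewrite ler_wpM2l ?maxj_ge0// dS// s0 (le_trans s_c).
  - apply: inorm_le_L1norm => //; [|exact: prediction_error_mxLinfloc|].
      exact/(stable_comp (stable_Hxm B hAm))/stable_lti/hurwitz_oppKf.
    move=> s /andP[s0 sc].
    apply: inorm_tracking_prediction_error_le => // r /andP[r0 rs].
    by apply: dc; rewrite r0 (le_trans rs).
rewrite mulrAC ler_pdivlMr ?subr_gt0// mulrBr mulr1 lerBlDr [S * _]mulrC.
by rewrite addrC -mulrA.
Qed.

Hypothesis performance :
  L1norm (HxmCBsAe Am B Ae kf) / (1 - L1norm (Gxm Am B kf) * maxj L) * g0 < gamma1.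

Lemma state_error_lt t : 0 <= t -> inorm (xr t - x t) < gamma1.
Proof.
move: t; apply: (continuous_barrier state_error_continuous).
- by rewrite (ref_state_init ref) adaptive_state_init subrr inorm0 ltW.
- by move=> t t0 dt; exact: le_lt_trans (inorm_state_error_le t0 dt) performance.
Qed.

Lemma control_error_le t : 0 <= t -> inorm (ur t - ua t) <=
  L1norm (filt kf) * maxj L * gamma1 + L1norm (CBsAe B Ae kf) * g0.
Proof.
move=> t0; have d_le s : 0 <= s -> inorm (xr s - x s) <= gamma1.
  by move=> s0; exact/ltW/state_error_lt.
rewrite control_errorE// addrC (le_trans (inormD _ _))// inormN lerD//.
- rewrite -mulrA; apply: inorm_le_L1norm => //; [exact: stable_filt|
    exact: uncertainty_error_mxLinfloc|].
  move=> s /andP[s0 _].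
  rewrite (le_trans (inorm_uncertainty_error_le s0 (d_le s s0)))//.
  by rewrite ler_wpM2l ?maxj_ge0 ?d_le.
- apply: inorm_le_L1norm => //; [exact/stable_lti/hurwitz_oppKf|
    exact: prediction_error_mxLinfloc|].
  move=> s /andP[s0 _].
  apply: inorm_tracking_prediction_error_le => // r /andP[r0 _].
  exact: d_le.
Qed.

End Tracking.

End AdaptiveSystem.

Theorem theorem1 (R : realType) (m p : nat)
  (Am : 'M[R]_(m + p)) (B Bv : 'M[R]_(m + p, m)) (Bp : 'M[R]_(m + p, p))
  (Ae : 'M[R]_(m + p)) (kf : 'I_m -> R) (T : R)
  (v : sgn R m) (X0 : set 'cV[R]_(m + p)) (x0 : 'cV[R]_(m + p))
  (f : R -> 'cV[R]_(m + p) -> 'cV[R]_m)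
  (rho_r gamma1 : R)
  (L l b : 'I_m -> R)        (* constants of f on Omega(rho) *)
  (Lr lr br : 'I_m -> R)     (* constants of f on Omega(rho_r) *)
  (x xh sh : sgn R (m + p)) (ua : sgn R m)
  (xr : sgn R (m + p)) (ur : sgn R m) :
  (* standing setup *)
  hurwitz Am -> \rank B = m ->
  bounded_sig v -> pw_cont v ->
  compact X0 -> x0 \in X0 ->
  (forall Z : set 'cV[R]_(m + p), compact Z ->
     exists L0 l0 b0 : 'I_m -> R, f_consts f Z L0 l0 b0) ->
  (forall j, 0 < kf j) ->
  hurwitz Ae -> Bp^T *m B = 0 -> row_mx B Bp \in unitmx -> 0 < T ->
  (* the adaptive closed-loop system and its (unique continuous) solution *)
  adaptive_sol Am Bv B Bp Ae kf T v f x0 x xh sh ua ->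
  (forall x' xh' sh' ua', adaptive_sol Am Bv B Bp Ae kf T v f x0 x' xh' sh' ua' ->
     forall t, 0 <= t -> x' t = x t /\ xh' t = xh t) ->
  (* the reference system and its (unique continuous) solution *)
  ref_sol Am Bv B kf v f x0 xr ur ->
  (forall xr' ur', ref_sol Am Bv B kf v f x0 xr' ur' ->
     forall t, 0 <= t -> xr' t = xr t) ->
  (* theorem hypotheses *)
  0 < rho_r -> 0 < gamma1 ->
  let rho := rho_r + gamma1 in
  f_consts f (Omega (k:=m + p) rho) L l b ->
  f_consts f (Omega (k:=m + p) rho_r) Lr lr br ->
  let Lf := maxj L in
  let bf := maxj b in
  let bf_r := maxj br in
  let rho_in := L1norm (sHm Am) * sup [set inorm z | z in X0] in
  let g0 := gamma0 Ae B T bf in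
  L1norm (Gxm Am B kf) * bf_r
    < rho_r - L1norm (Hxm Am Bv) * Linf v - rho_in ->
  L1norm (Gxm Am B kf) * Lf < 1 ->
  L1norm (HxmCBsAe Am B Ae kf) / (1 - L1norm (Gxm Am B kf) * Lf) * g0 < gamma1 ->
  let gamma2 := L1norm (filt kf) * Lf * gamma1 + L1norm (CBsAe B Ae kf) * g0 in
  let rho_ua := L1norm (filt kf) * bf_r + gamma2 in
  (forall t, 0 <= t -> inorm (x t) <= rho) /\
  (forall t, 0 <= t -> inorm (ua t) <= rho_ua) /\
  (forall t, 0 <= t -> inorm (xr t - x t) <= gamma1) /\
  (forall t, 0 <= t -> inorm (ur t - ua t) <= gamma2).
Proof.
move=> hAm _ bv pv cX0 x0X f_lip kf0 hAe BpB uB T0 adaptive _ ref _ _ gamma1_gt0.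
move=> rho f_rho f_rho_r Lf bf bf_r rho_in g0 C1 C2 C3 gamma2 rho_ua.
have loc_v := pw_cont_mxLinfloc bv pv.
have x0_in : L1norm (sHm Am) * inorm x0 <= rho_in.
  apply: ler_wpM2l; first exact/L1norm_ge0/stable_lti.
  apply: ub_le_sup; first exact: compact_inorm_bounded.
  by exists x0 => //; exact/set_mem.
have v_le t : 0 <= t -> inorm (v t) <= Linf v.
  move=> t0; apply: ub_le_sup; last by exists t.
  by have [M vM] := bv; exists M => _ [s /= s0 <-]; exact: vM.
have xr_lt := ref_state_lt hAm kf0 loc_v f_lip ref f_rho_r x0_in v_le C1.
have xr_le t (t0 : 0 <= t) := ltW (xr_lt t t0).
have d_lt := state_error_lt hAm hAe kf0 BpB uB T0 loc_v f_lip adaptive ref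
  f_rho xr_le gamma1_gt0 C2 C3.
have du_le := control_error_le hAm hAe kf0 BpB uB T0 loc_v f_lip adaptive ref
  f_rho xr_le gamma1_gt0 C2 C3.
split; first by move=> t t0; exact: (inorm_state_le xr_le t0 (ltW (d_lt t t0))).
split; last by split=> t t0; [exact/ltW/d_lt|exact: du_le].
move=> t t0; rewrite -[ua t](subKr (ur t)) (le_trans (inormB _ _))// lerD ?du_le//.
exact: (inorm_ref_input_le kf0 f_lip ref f_rho_r xr_le t0).
Qed.
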